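(* Consider the problem $$\min_{x_i\in X_i,\ z\in Z}\ \sum_{i=1}^N f_i(x_i)\quad\text{s.t.}\quad Dx+Hz=0,$$ and let $\{x^k,z^k,p^k\}_{k\ge 0}$ be the sequence generated by the asynchronous ADMM algorithm described in the context, under the standing assumptions (saddle point existence, decoupled constraints, infinitely often update) listed there. Then the sequence $\{x^k,z^k,p^k\}$ converges almost surely to a saddle point of the Lagrangian function $L(x,z,p)=\sum_{i=1}^N f_i(x_i)-p'(Dx+Hz)$ (the limiting saddle point may depend on the sample path).
   Context: **Problem.** Each $f_i:\mathbb{R}^n\to\mathbb{R}$ ($i=1,\dots,N$) is convex (possibly nonsmooth); $X_i\subseteq\mathbb{R}^n$ and $Z\subseteq\mathbb{R}^W$ are closed convex sets; $D\in\mathbb{R}^{W\times nN}$, $H\in\mathbb{R}^{W\times W}$. Write $x=[x_1',\dots,x_N']'\in\mathbb{R}^{nN}$ with $x_i\in\mathbb{R}^n$, $X=X_1\times\dots\times X_N$, $F(x)=\sum_{i=1}^N f_i(x_i)$. A prime denotes transpose; $\|\cdot\|$ is the Euclidean norm. For a vector $w$ and index set $S$, $[w]_S$ is the vector of the same dimension with the components outside $S$ replaced by $0$. **Saddle points.** The Lagrangian is $L(x,z,p)=F(x)-p'(Dx+Hz)$. A saddle point is a triple $(x^*,z^*,p^* )\in X\times Z\times\mathbb{R}^W$ with $L(x^*,z^*,p)\le L(x^*,z^*,p^* )\le L(x,z,p^* )$ for all $x\in X$, $z\in Z$, $p\in\mathbb{R}^W$. **Standing assumptions.** 1. (Existence of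 a saddle point) $L$ has a saddle point. 2. (Decoupled constraints) $H$ is diagonal and invertible; each row of $D$ has exactly one nonzero element; $D$ has no column of all zeros. 3. (Infinitely often update) $\mathbb{P}(\Psi^k=\psi)>0$ for all $k$ and all $\psi\in\Pi$ (with $\Psi^k$, $\Pi$ as below). **Partition and activation.** $\Pi$ is a fixed proper partition of $\{1,\dots,W\}$: a partition such that any two coordinates $z_i,z_j$ coupled in the constraint set $Z$ lie in the same block, i.e. $Z$ is the product over the blocks $\psi\in\Pi$ of its projections on the coordinates in $\psi$. For $\psi\in\Pi$, $\Phi(\psi)\subseteq\{1,\dots,N\}$ is the set of indices $i$ such that $x_i$ appears (with a nonzero coefficient) in one of the rows $l\in\psi$ of $Dx+Hz=0$. At each iteration $k\ge0$ a random element $\Psi^k$ of $\Pi$ is realized, and $\Phi^k=\Phi(\Psi^k)$; the pairs $(\Phi^k,\Psi^k)$ are independent and identically distributed over $k$. Realizations are denoted $\phi^k,\psi^k$, with complements $\bar\phi^k$ in $\{1,\dots,N\}$ and $\bar\psi^k$ in $\{1,\dots,W\}$. **Notation.** $D_i\in\mathbb{R}^{W\times nN}$ agrees with $D$ on the columns corresponding to $x_i$ and is zero elsewhere; $H_l\in\mathbb{R}^{W\times W}$ agrees with $H$ in the $l$-th diagonal entry and is zero elsewhere; $D_{\phi^k}=\sum_{i\in\phi^k}D_i$, $H_{\psi^k}=\sum_{l\in\psi^k}H_l$, $f^k(x)=\sum_{i\in\phi^k}f_i(x_i)$. **Asynchronous ADMM algorithm.** Fix a penalty parameter $\beta>0$.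 Start with arbitrary (deterministic) $x^0\in X$, $z^0\in Z$ and $p^0=0$. At iteration $k$: - $x^{k+1}\in\arg\min_{x\in X} f^k(x)-(p^k)'D_{\phi^k}x+\frac{\beta}{2}\|D_{\phi^k}x+Hz^k\|^2$, with $x_i^{k+1}=x_i^k$ for $i\in\bar\phi^k$; - $z^{k+1}\in\arg\min_{z\in Z}-(p^k)'H_{\psi^k}z+\frac{\beta}{2}\|H_{\psi^k}z+D_{\phi^k}x^{k+1}\|^2$, with $z_l^{k+1}=z_l^k$ for $l\in\bar\psi^k$; - $p^{k+1}=p^k-\beta[D_{\phi^k}x^{k+1}+H_{\psi^k}z^{k+1}]_{\psi^k}$. The minimizers in these updates are assumed to exist. *)

(* Defs.v *)
From HB Require Import structures.
From mathcomp Require Import all_boot all_order all_algebra.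
From mathcomp Require Import all_classical all_reals all_analysis.

Set Implicit Arguments.
Unset Strict Implicit.
Unset Printing Implicit Defensive.

Import Order.TTheory GRing.Theory Num.Theory.
Import numFieldNormedType.Exports.

Local Open Scope classical_set_scope.
Local Open Scope ring_scope.

Definition dot (R : realType) (m : nat) (u v : 'cV[R]_m) : R :=
  (u^T *m v) 0 0.

(* The library norm on matrices is the sup norm. *)
Definition enorm (R : realType) (m : nat) (v : 'cV[R]_m) : R :=
  Num.sqrt (dot v v).

Definition restr (R : realType) (m : nat) (S : {set 'I_m}) (w : 'cV[R]_m) :
    'cV[R]_m :=
  \col_l (if l \in S then w l 0 else 0).

(* A vector of R^(nN) is a column whose N consecutive blocks have length n;
   [mxvec_index i j] is the position of the j-th entry of the i-th block. *)
Definition block (R : realType) (N n : nat) (i : 'I_N) (x : 'cV[R]_(N * n)) :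
    'cV[R]_n :=
  \col_j x (mxvec_index i j) 0.

Definition prodX (R : realType) (N n : nat) (X : 'I_N -> set 'cV[R]_n) :
    set 'cV[R]_(N * n) :=
  [set x | forall i, X i (block i x)].

Definition sepF (R : realType) (N n : nat) (f : 'I_N -> 'cV[R]_n -> R)
    (phi : {set 'I_N}) (x : 'cV[R]_(N * n)) : R :=
  \sum_(i in phi) f i (block i x).

Definition lagrangian (R : realType) (N n W : nat)
    (f : 'I_N -> 'cV[R]_n -> R) (D : 'M[R]_(W, N * n)) (H : 'M[R]_W)
    (x : 'cV[R]_(N * n)) (z p : 'cV[R]_W) : R :=
  sepF f [set: 'I_N]%SET x - dot p (D *m x + H *m z).

Definition saddle_point (R : realType) (N n W : nat)
    (f : 'I_N -> 'cV[R]_n -> R) (X : 'I_N -> set 'cV[R]_n)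
    (Z : set 'cV[R]_W) (D : 'M[R]_(W, N * n)) (H : 'M[R]_W)
    (xs : 'cV[R]_(N * n)) (zs ps : 'cV[R]_W) : Prop :=
  [/\ prodX X xs, Z zs &
    forall x z p, prodX X x -> Z z ->
      lagrangian f D H xs zs p <= lagrangian f D H xs zs ps /\
      lagrangian f D H xs zs ps <= lagrangian f D H x z ps].

Definition decoupled (R : realType) (N n W : nat)
    (D : 'M[R]_(W, N * n)) (H : 'M[R]_W) : Prop :=
  [/\ is_diag_mx H, H \in unitmx,
      (forall l : 'I_W, exists! c : 'I_(N * n), D l c != 0) &
      (forall c : 'I_(N * n), exists l : 'I_W, D l c != 0)].

(* The projection of Z on the coordinates in psi is identified with
   [restr psi @` Z], its coordinates outside psi being padded with 0. *)
Definition proper_partition (R : realType) (W : nat)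
    (Pi : {set {set 'I_W}}) (Z : set 'cV[R]_W) : Prop :=
  finset.partition Pi [set: 'I_W]%SET /\
  Z = [set z | forall psi, psi \in Pi -> (restr psi @` Z) (restr psi z)].

Definition active (R : realType) (N n W : nat) (D : 'M[R]_(W, N * n))
    (psi : {set 'I_W}) : {set 'I_N} :=
  [set i | [exists l in psi, [exists j, D l (mxvec_index i j) != 0]]]%SET.

Definition Dcols (R : realType) (N n W : nat) (D : 'M[R]_(W, N * n))
    (i : 'I_N) : 'M[R]_(W, N * n) :=
  \matrix_(l, c) (if [exists j, c == mxvec_index i j] then D l c else 0).

Definition Hentry (R : realType) (W : nat) (H : 'M[R]_W) (l : 'I_W) : 'M[R]_W :=
  \matrix_(a, b) (if (a == l) && (b == l) then H a b else 0).

Definition Dsum (R : realType) (N n W : nat) (D : 'M[R]_(W, N * n))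
    (phi : {set 'I_N}) : 'M[R]_(W, N * n) :=
  \sum_(i in phi) Dcols D i.

Definition Hsum (R : realType) (W : nat) (H : 'M[R]_W) (psi : {set 'I_W}) :
    'M[R]_W :=
  \sum_(l in psi) Hentry H l.

Definition is_argmin (R : realType) (T : Type) (S : set T) (g : T -> R)
    (a : T) : Prop :=
  S a /\ forall b, S b -> g a <= g b.

(* One iteration, in which the blocks phi of x and the components psi of z
   and p are updated, from (x, z, p) to (x', z', p'). *)
Definition admm_step (R : realType) (N n W : nat)
    (f : 'I_N -> 'cV[R]_n -> R) (X : 'I_N -> set 'cV[R]_n)
    (Z : set 'cV[R]_W) (D : 'M[R]_(W, N * n)) (H : 'M[R]_W) (beta : R)
    (phi : {set 'I_N}) (psi : {set 'I_W})
    (x : 'cV[R]_(N * n)) (z p : 'cV[R]_W)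
    (x' : 'cV[R]_(N * n)) (z' p' : 'cV[R]_W) : Prop :=
  [/\ is_argmin (prodX X)
        (fun y => sepF f phi y - dot p (Dsum D phi *m y)
                  + beta / 2 * enorm (Dsum D phi *m y + H *m z) ^+ 2) x'
      /\ (forall i, i \notin phi -> block i x' = block i x),
      is_argmin Z
        (fun v => - dot p (Hsum H psi *m v)
                  + beta / 2 * enorm (Hsum H psi *m v + Dsum D phi *m x') ^+ 2)
        z'
      /\ (forall l, l \notin psi -> z' l 0 = z l 0) &
      p' = p - beta *: restr psi (Dsum D phi *m x' + Hsum H psi *m z')].

Definition async_admm (R : realType) (N n W : nat)
    (f : 'I_N -> 'cV[R]_n -> R) (X : 'I_N -> set 'cV[R]_n)
    (Z : set 'cV[R]_W) (D : 'M[R]_(W, N * n)) (H : 'M[R]_W) (beta : R)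
    (x0 : 'cV[R]_(N * n)) (z0 : 'cV[R]_W)
    (phi : nat -> {set 'I_N}) (psi : nat -> {set 'I_W})
    (x : nat -> 'cV[R]_(N * n)) (z p : nat -> 'cV[R]_W) : Prop :=
  [/\ x 0%N = x0, z 0%N = z0, p 0%N = 0 &
    forall k, admm_step f X Z D H beta (phi k) (psi k)
                (x k) (z k) (p k) (x k.+1) (z k.+1) (p k.+1)].

(* Independent and identically distributed random elements of a finite type,
   all of whose subsets are measurable. *)
Definition iid (R : realType) (d : measure_display) (Omega : measurableType d)
    (P : probability Omega R) (T : finType) (Y : nat -> Omega -> T) : Prop :=
  [/\ forall k (B : set T), measurable (Y k @^-1` B),
      forall k (B : set T), P (Y k @^-1` B) = P (Y 0%N @^-1` B) &
      forall (J : seq nat) (B : nat -> set T), uniq J ->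
        P (\bigcap_(k in [set` J]) (Y k @^-1` B k)) =
        (\prod_(k <- J) P (Y k @^-1` B k))%E].

(* Main.v *)
Require Import Defs.
From HB Require Import structures.
From mathcomp Require Import all_boot all_order all_algebra.
From mathcomp Require Import all_classical all_reals all_analysis.
From mathcomp Require Import ring lra.

(** Since every row of D involves a single x_i, the block updates of x are
    independent of each other, and one iteration with active block psi
    performs exactly the psi-part of a synchronous ADMM step (y, v, mu) taken
    from the same (z, p). The synchronous step satisfies, for every saddle
    point (xs, zs, ps),
      |mu - ps|^2 / beta + beta |H (v - zs)|^2
        <= |p - ps|^2 / beta + beta |H (z - zs)|^2 - beta |D y + H z|^2,
    so weighting each coordinate by the inverse probability of its block turns
    the left-hand distance into a supermartingale whose drift is the residual
    beta |D y + H z|^2. Minimizers being unique, the state is a function of the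
    finite history of active blocks, and supermartingale convergence is proved
    by upcrossings on the tree of histories. Almost surely the residual thus
    tends to 0 and the distances to finitely many saddle points, affinely
    spanning all of them, converge; hence the distance to every saddle point
    converges. A cluster point of (z, p) is a saddle point by lower
    semicontinuity of the f_i, its distance tends to 0 along a subsequence,
    hence along the whole sequence; x follows as every block is active
    infinitely often. *)

Set Implicit Arguments.
Unset Strict Implicit.
Unset Printing Implicit Defensive.

Import Order.TTheory GRing.Theory Num.Theory.
Import numFieldNormedType.Exports.

Local Open Scope classical_set_scope.
Local Open Scope ring_scope.

(** * Supermartingales on the tree of histories *)

Section HistoryTree.
Context (R : realType) (T : finType) (pi : T -> R).
Hypothesis pi_ge0 : forall t, 0 <= pi t.

(* The conditional expectation of g, k steps after the history s. *)
Fixpoint tree_exp k (g : seq T -> R) s : R :=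
  if k is k'.+1 then \sum_t pi t * tree_exp k' g (rcons s t) else g s.

Definition supermart (K : seq T -> R) :=
  forall s, \sum_t pi t * K (rcons s t) <= K s.

Lemma tree_exp_le k g K s : (forall s, g s <= K s) -> supermart K ->
  tree_exp k g s <= K s.
Proof.
move=> gK sK; elim: k s => [|k IH] s //=.
by apply: le_trans (sK s); apply: ler_sum => t _; rewrite ler_wpM2l.
Qed.

Lemma supermartZ c K : 0 <= c -> supermart K -> supermart (fun s => c * K s).
Proof.
move=> c0 sK s; rewrite (eq_bigr (fun t => c * (pi t * K (rcons s t)))).
  by rewrite -mulr_sumr ler_wpM2l.
by move=> t _; rewrite mulrCA.
Qed.

Context d (Omega : measurableType d) (P : probability Omega R).
Variable Y : nat -> Omega -> T.

Definition history k w : seq T := mkseq (Y^~ w) k.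

Definition cylinder s : set Omega := [set w | history (size s) w = s].

Hypothesis cylinder_meas : forall s, measurable (cylinder s).
Hypothesis cylinderP : forall s, P (cylinder s) = (\prod_(t <- s) pi t)%:E.

Lemma size_history k w : size (history k w) = k.
Proof. by rewrite size_mkseq. Qed.

Lemma historyS k w : history k.+1 w = rcons (history k w) (Y k w).
Proof. by rewrite /history mkseqS. Qed.

Lemma take_history j k w : (j <= k)%N -> take j (history k w) = history j w.
Proof.
by move=> jk; rewrite /history /mkseq -map_take take_iota (minn_idPl jk).
Qed.

Lemma cylinder_rcons s t w :
  cylinder (rcons s t) w <-> cylinder s w /\ Y (size s) w = t.
Proof.
rewrite /cylinder /= size_rcons historyS; split.
  by move=> /rcons_inj[].
by case=> -> ->.
Qed.

(** Markov's inequality given the history [s], by induction on [k]: the event splits, according to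
    the next block, into events of the same kind on longer cylinders. *)
Lemma tree_markov k s g : (forall s, 0 <= g s) ->
  let E := [set w | cylinder s w /\ 1 <= g (history (size s + k) w)] in
  measurable E /\ (P E <= (\prod_(t <- s) pi t * tree_exp k g s)%:E)%E.
Proof.
move=> g0; elim: k s => [|k IH] s /=.
  rewrite addn0; have [g1|g1] := leP 1 (g s).
    rewrite (_ : [set _ | _] = cylinder s).
      split; [exact: cylinder_meas|rewrite cylinderP lee_fin ler_peMr//].
      exact: prodr_ge0.
    by apply/seteqP; split => w /=; [case|move=> h; split=> //; rewrite h].
  rewrite (_ : [set _ | _] = set0).
    rewrite measure0 lee_fin; split; first exact: measurable0.
    by rewrite mulr_ge0 ?prodr_ge0.
  by apply/seteqP; split => w //= [-> ]; rewrite leNgt g1.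
set F := fun t => [set w | cylinder (rcons s t) w /\
                           1 <= g (history (size (rcons s t) + k) w)].
have -> : [set w | cylinder s w /\ 1 <= g (history (size s + k.+1) w)] =
    \big[setU/set0]_t F t.
  rewrite -bigcup_seq; apply/seteqP; split => w /=.
    move=> [cw gw]; exists (Y (size s) w); first by rewrite /= mem_index_enum.
    split; first exact/cylinder_rcons.
    by rewrite size_rcons addSnnS.
  move=> [t _ [/cylinder_rcons[cw _]]].
  by rewrite size_rcons addSnnS.
split; first by apply: bigsetU_measurable => t _; case: (IH (rcons s t)).
apply: (@le_trans _ _ (\sum_t P (F t))%E).
  elim: (index_enum T) => [|t r IHr]; first by rewrite !big_nil measure0.
  rewrite !big_cons; apply: le_trans (_ : P (F t) + P (\big[setU/set0]_(j <- r) F j) <= _)%E.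
    apply: measureU2; first by case: (IH (rcons s t)).
    by apply: bigsetU_measurable => i _; case: (IH (rcons s i)).
  by rewrite leeD2l// IHr.
rewrite mulr_sumr -sumEFin; apply: lee_sum => t _.
case: (IH (rcons s t)) => _ /le_trans; apply.
by rewrite lee_fin -cats1 big_cat big_seq1 /= mulrA.
Qed.

(** A maximal inequality free of stopping times: as [M] grows along paths, the events [1 <= M]
    increase with time; Markov's inequality and [M <= K] bound each by [e], and continuity from
    below bounds their union. *)
Lemma tree_negligible (A : set Omega) :
  (forall e : R, 0 < e -> exists K M : seq T -> R,
    [/\ supermart K, K [::] <= e, (forall s, 0 <= M s <= K s),
        (forall s t, M s <= M (rcons s t)) &
        forall w, A w -> exists k, 1 <= M (history k w)]) ->
  P.-negligible A.
Proof.
move=> H.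
have step (m : nat) : exists B, [/\ measurable B, A `<=` B &
    (P B <= (m.+1%:R^-1)%:E)%E].
  have [|K [M [sK Ke MK Mm AM]]] := H (m.+1%:R^-1); first by rewrite invr_gt0.
  have M0 s : 0 <= M s by case/andP: (MK s).
  pose E k := [set w | 1 <= M (history k w)].
  have mE k : measurable (E k) /\ (P (E k) <= (m.+1%:R^-1)%:E)%E.
    have [] := @tree_markov k [::] M M0.
    rewrite (_ : [set _ | _] = E k); last first.
      by apply/seteqP; split => w /=; [case|move=> ?; split].
    move=> mE PE; split=> //; apply: le_trans PE _.
    rewrite big_nil mul1r lee_fin; apply: le_trans Ke.
    by apply: tree_exp_le => // s; case/andP: (MK s).
  have ndE : nondecreasing_seq E.
    apply/nondecreasing_seqP => k; rewrite subsetEset => w /= h.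
    by apply: le_trans h _; rewrite historyS.
  exists (\bigcup_k E k); split.
  - by apply: bigcup_measurable => k _; case: (mE k).
  - by move=> w /AM[k ?]; exists k.
  - have mU : measurable (\bigcup_k E k).
      by apply: bigcup_measurable => k _; case: (mE k).
    have cv := @nondecreasing_cvg_mu _ _ _ P E (fun k => (mE k).1) mU ndE.
    rewrite -(cvg_lim _ cv)//; apply: lime_le.
      by apply/cvg_ex; exists (P (\bigcup_k E k)).
    by apply: nearW => k; case: (mE k).
have [B HB] := choice step.
have mB : measurable (\bigcap_m B m).
  by apply: bigcap_measurable => // k _; case: (HB k).
exists (\bigcap_m B m); split=> //; last first.
  by move=> w Aw m _; case: (HB m) => _ + _; apply.
apply/eqP; rewrite -measure_le0; apply/lee_addgt0Pr => e e0.
rewrite add0e.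
have [m _ me] : exists2 m : nat, True & m.+1%:R^-1 <= e.
  exists (Num.truncn e^-1) => //; rewrite -[leRHS]invrK lef_pV2 ?posrE ?invr_gt0//.
  exact/ltW/truncnS_gt.
case: (HB m) => mBm _ PB; apply: le_trans (_ : P (B m) <= _)%E.
  by apply: le_measure; rewrite ?inE// => w; apply.
by apply: le_trans PB _; rewrite lee_fin.
Qed.

End HistoryTree.

(** * Upcrossings of an interval *)

Section Upcrossing.
Context (R : realType) (a b : R).
Hypothesis ab : a < b.

(* The flag says whether one unit of v is currently held: it is bought when
   v <= a and sold when v >= b; the counter is the number of sales. *)
Fixpoint upcross (v : nat -> R) k : bool * nat :=
  if k is k'.+1 then
    let: (h, m) := upcross v k' in
    if h then (if b <= v k then (false, m.+1) else (true, m))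
    else (v k <= a, m)
  else (v 0%N <= a, 0%N).

(** Capital of the trader of [upcross], starting from [a]: the decision made at time [k'] earns the
    next increment of [v], as in a discrete stochastic integral. *)
Fixpoint wealth (v : nat -> R) k : R :=
  if k is k'.+1 then
    wealth v k' + (if (upcross v k').1 then v k - v k' else 0)
  else a.

Lemma upcross_eq v v' k : (forall j, (j <= k)%N -> v j = v' j) ->
  upcross v k = upcross v' k.
Proof.
elim: k => [|k IH] h /=; first by rewrite h.
by rewrite IH ?h// => j jk; apply: h; exact: leqW.
Qed.

Lemma wealth_eq v v' k : (forall j, (j <= k)%N -> v j = v' j) ->
  wealth v k = wealth v' k.
Proof.
elim: k => [|k IH] h //=.
have h' j : (j <= k)%N -> v j = v' j by move=> jk; apply: h; exact: leqW.
by rewrite IH// (upcross_eq h') !h.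
Qed.

(** A unit costs at most [a], which the initial capital covers; selling it for at least [b] restores
    that capital and leaves a profit of [b - a]. *)
Lemma wealth_ge v k :
  (if (upcross v k).1 then v k else a) + (b - a) * (upcross v k).2%:R
  <= wealth v k.
Proof.
elim: k => [|k /=]; first by rewrite /= mulr0 addr0; case: ifP.
case: (upcross v k) => [[] m] /=.
  by case: (leP b (v k.+1)) => /= bv IH; rewrite -?natr1; lra.
by case: (leP (v k.+1) a) => /= va IH; lra.
Qed.

Lemma upcross_mono v k : ((upcross v k).2 <= (upcross v k.+1).2)%N.
Proof. by rewrite /=; case: (upcross v k) => [[] m] //=; case: ifP => /=. Qed.

Lemma upcross_le v j k : (j <= k)%N -> ((upcross v j).2 <= (upcross v k).2)%N.
Proof.
move=> jk; rewrite -(subnKC jk); elim: (k - j)%N => [|i IH]; first by rewrite addn0.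
by rewrite addnS; apply: leq_trans IH (upcross_mono _ _).
Qed.

Lemma upcross_buy v k : v k <= a -> (upcross v k).1.
Proof.
case: k => [|k] /= va //; case: (upcross v k) => [[] m] //=.
by rewrite leNgt (le_lt_trans va ab).
Qed.

(** By [upcross_buy] a unit is held at time [j]; it can only leave by a sale, which happens at time
    [k] at the latest. *)
Lemma upcross_sell v j k : (j < k)%N -> v j <= a -> b <= v k ->
  ((upcross v j).2 < (upcross v k).2)%N.
Proof.
move=> jk va vb.
have inv i : ((upcross v j).2 < (upcross v (j + i)).2)%N \/
    ((upcross v (j + i)).1 /\ (upcross v (j + i)).2 = (upcross v j).2).
  elim: i => [|i [IH|[h e]]]; first by right; rewrite addn0 upcross_buy.
    by left; rewrite addnS; apply: leq_trans IH (upcross_mono _ _).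
  rewrite addnS /=; case: (upcross v (j + i)) h e => [[] m] //= _ ->.
  by case: ifP => /=; [left|right].
case: k jk vb => // k jk vb.
case: (inv (k - j)%N); rewrite subnKC//.
  by move=> h; apply: leq_trans h (upcross_mono _ _).
by move=> /=; case: (upcross v k) => [[] m] /= [] // _ ->; rewrite vb.
Qed.

Lemma upcross_unbounded v :
  (forall K, exists2 k, (K <= k)%N & v k <= a) ->
  (forall K, exists2 k, (K <= k)%N & b <= v k) ->
  forall m, exists k, (m <= (upcross v k).2)%N.
Proof.
move=> lo hi; elim=> [|m [k mk]]; first by exists 0%N.
have [j kj vj] := lo k; have [i ji vi] := hi j.+1.
by exists i; apply: leq_ltn_trans (upcross_sell ji vj vi);
  apply: leq_trans mk (upcross_le _ kj).
Qed.

End Upcrossing.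

(** * Ultrafilter limits and convergence from upcrossings *)

Lemma ultra_fmap (S T : Type) (f : S -> T) (F : set_system S) :
  UltraFilter F -> UltraFilter (f @ F).
Proof.
move=> FU; split=> [|G PG sFG]; first exact: fmap_proper_filter.
apply/seteqP; split => // A GA.
have [//|FnA] := in_ultra_setVsetC (f @^-1` A) FU.
have GnA : G (~` A) by apply: sFG.
by have [t [At /(_ At)]] := filter_ex (filterI GA GnA).
Qed.

(** Compactness of a segment in ultrafilter form; it takes the place of extracting a convergent
    subsequence. *)
Lemma ultra_bounded_cvg (R : realType) (S : Type) (U : set_system S)
    (v : S -> R) C :
  UltraFilter U -> (\forall k \near U, `|v k| <= C) ->
  exists l : R, v @ U --> l.
Proof.
move=> UU vC.
have := @segment_compact R (- C) C; rewrite compact_ultra.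
move=> /(_ (v @ U) (ultra_fmap v UU)) [|l [_ vl]]; last by exists l.
by apply: filterS vC => k /=; rewrite in_itv/= -ler_norml.
Qed.

(** An ultrafilter provides a cluster value [L]. If [v] did not tend to [L], it would recur both
    near [L] and at distance at least [e] on one side, hence cross a rational interval infinitely
    often. Rational endpoints leave only countably many pairs to treat almost surely. *)
Lemma bounded_upcrossings_cvg (R : realType) (v : nat -> R) :
  (exists C, forall k, `|v k| <= C) ->
  (forall a b : rat, a < b -> exists m, forall k,
     ((upcross (ratr a) (ratr b : R) v k).2 <= m)%N) ->
  cvgn v.
Proof.
move=> [C vC] up.
have [U [UU sU]] := @ultraFilterLemma nat \oo _.
have PU : ProperFilter U by exact: ultra_proper.
have [|L vL] := @ultra_bounded_cvg R _ U v C UU; first exact: nearW.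
apply/cvg_ex; exists L; apply/cvgrPdist_lt => e e0.
have near_i (e' : R) K : 0 < e' -> exists2 k, (K <= k)%N & `|L - v k| < e'.
  move=> e'0; have /cvgrPdist_lt/(_ _ e'0) h := vL.
  have hK : U [set k | (K <= k)%N] by apply: sU; exact: nbhs_infty_ge.
  by have [k [? ?]] := filter_ex (filterI hK h); exists k.
apply: contrapT => nlim.
have far K : exists2 k, (K <= k)%N & e <= `|L - v k|.
  apply: contrapT => nK; apply: nlim; exists K => // k /= Kk.
  by rewrite ltNge; apply/negP => h; apply: nK; exists k.
suff [a [b [ab lo hi]]] : exists a b : rat, [/\ a < b,
    (forall K, exists2 k, (K <= k)%N & v k <= ratr a) &
    (forall K, exists2 k, (K <= k)%N & ratr b <= v k)].
  have [m mP] := up a b ab.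
  have ab' : ratr a < ratr b :> R by rewrite ltr_rat.
  have [k] := upcross_unbounded ab' lo hi m.+1.
  by rewrite ltnNge mP.
have [hi|lo] := pselect (forall K, exists2 k, (K <= k)%N & e <= v k - L).
  have [|a /itvP aI] := @rat_in_itvoo R (L + e / 3) (L + e / 2); first by lra.
  have [|b /itvP bI] := @rat_in_itvoo R (L + e / 2) (L + e); first by lra.
  exists a, b; split.
  - by rewrite -(ltr_rat R) (@lt_trans _ _ (L + e/2)) ?aI ?bI.
  - move=> K; have [|k Kk] := near_i (e / 3) K; first by lra.
    rewrite ltr_norml => /andP[? ?]; exists k => //.
    apply: le_trans (_ : L + e / 3 <= _); [lra|by rewrite ltW ?aI].
  - move=> K; have [k Kk h] := hi K; exists k => //.
    apply: le_trans (_ : L + e <= _); [by rewrite ltW ?bI|lra].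
(* Deviations of size [e] above [L] eventually stop, so those below recur. *)
have [|a /itvP aI] := @rat_in_itvoo R (L - e) (L - e / 2); first by lra.
have [|b /itvP bI] := @rat_in_itvoo R (L - e / 2) (L - e / 3); first by lra.
exists a, b; split.
- by rewrite -(ltr_rat R) (@lt_trans _ _ (L - e/2)) ?aI ?bI.
- move=> K.
  have [K' hK'] : exists K', forall k, (K' <= k)%N -> v k - L < e.
    apply: contrapT => nK; apply: lo => K'; apply: contrapT => nk; apply: nK.
    exists K' => k K'k; rewrite ltNge; apply/negP => h; apply: nk.
    by exists k.
  have [k] := far (maxn K K'); rewrite geq_max => /andP[Kk K'k].
  have := hK' _ K'k => h1; rewrite ler_normr => /orP[h|h]; last by lra.
  exists k => //; apply: le_trans (_ : L - e <= _); [lra|by rewrite ltW ?aI].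
- move=> K; have [|k Kk] := near_i (e / 3) K; first by lra.
  rewrite ltr_norml => /andP[? ?]; exists k => //.
  by apply: le_trans (_ : L - e / 3 <= _); [rewrite ltW ?bI|lra].
Qed.

(** * Almost sure convergence of nonnegative supermartingales *)

Section SupermartingaleConvergence.
Context (R : realType) (T : finType) (pi : T -> R).
Hypothesis pi_ge0 : forall t, 0 <= pi t.
Hypothesis pi_sum : \sum_t pi t = 1.
Context d (Omega : measurableType d) (P : probability Omega R).
Variable Y : nat -> Omega -> T.
Hypothesis cylinder_meas : forall s, measurable (cylinder Y s).
Hypothesis cylinderP : forall s, P (cylinder Y s) = (\prod_(t <- s) pi t)%:E.

(** The level [c^-1] is reached with probability at most [c * K [::] <= e], and an unbounded [M]
    reaches every level. *)
Lemma tree_ae_bounded (K M : seq T -> R) :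
  supermart pi K -> (forall s, 0 <= M s <= K s) ->
  (forall s t, M s <= M (rcons s t)) ->
  {ae P, forall w, exists C, forall k, M (history Y k w) <= C}.
Proof.
move=> sK MK Mm; apply: (tree_negligible pi_ge0 cylinder_meas cylinderP).
have K0 : 0 <= K [::] by case/andP: (MK [::]) => /le_trans; apply.
move=> e e0; pose c := e / (K [::] + 1).
have c0 : 0 < c by rewrite divr_gt0// ltr_wpDl.
exists (fun s => c * K s), (fun s => c * M s); split.
- exact: supermartZ (ltW c0) sK.
- by rewrite /c mulrAC ler_pdivrMr ?ltr_wpDl// ler_pM2l// lerDl.
- by move=> s; case/andP: (MK s) => ? ?; rewrite mulr_ge0 ?(ltW c0)//= ler_pM2l.
- by move=> s t; rewrite ler_pM2l.
- move=> w /= nb; apply: contrapT => h; apply: nb; exists c^-1 => k.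
  rewrite leNgt; apply/negP => ck; apply: h; exists k.
  by rewrite -(@mulfV _ c) ?gt_eqF// ler_pM2l// ltW.
Qed.

Variables V res : seq T -> R.
Hypothesis V_ge0 : forall s, 0 <= V s.
Hypothesis res_ge0 : forall s, 0 <= res s.
Hypothesis V_decr : forall s, \sum_t pi t * V (rcons s t) <= V s - res s.

Let path s j := V (take j s).

Let path_rcons s t j : (j <= size s)%N -> path (rcons s t) j = path s j.
Proof. by move=> js; rewrite /path -cats1 takel_cat. Qed.

Let path_history k w j : (j <= k)%N ->
  path (history Y k w) j = V (history Y j w).
Proof. by move=> jk; rewrite /path take_history. Qed.

(** Whether a unit is held is decided by [s] alone, so appending [t] changes the wealth by 0 or by
    the increment of [V], whose mean is at most [- res s]. *)
Lemma wealth_supermart a b :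
  supermart pi (fun s => wealth a b (path s) (size s)).
Proof.
move=> s.
have W t : wealth a b (path (rcons s t)) (size (rcons s t)) =
    wealth a b (path s) (size s) +
    (if (upcross a b (path s) (size s)).1 then V (rcons s t) - V s else 0).
  rewrite size_rcons /= (wealth_eq _ _ (@path_rcons s t)).
  rewrite (upcross_eq _ _ (@path_rcons s t)) (@path_rcons s t (size s))// /path take_size.
  by rewrite take_oversize ?size_rcons.
under eq_bigr do rewrite W mulrDr.
rewrite big_split /= -mulr_suml pi_sum mul1r gerDl.
case: (upcross a b (path s) (size s)).1 => /=; last first.
  by rewrite big1// => t _; rewrite mulr0.
under eq_bigr do rewrite mulrBr.
rewrite sumrB -mulr_suml pi_sum mul1r subr_le0.
by apply: le_trans (V_decr s) _; rewrite gerBl.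
Qed.

Let count a b s : R := (b - a) * (upcross a b (path s) (size s)).2%:R.

Let count_mono a b s t : a < b -> count a b s <= count a b (rcons s t).
Proof.
move=> ab; rewrite ler_pM2l ?subr_gt0// ler_nat size_rcons.
by rewrite -(upcross_eq _ _ (@path_rcons s t)) upcross_mono.
Qed.

Let count_wealth a b s : 0 <= a -> a < b ->
  0 <= count a b s <= wealth a b (path s) (size s).
Proof.
move=> a0 ab; rewrite mulr_ge0 ?subr_ge0 ?(ltW ab)//=.
apply: le_trans (wealth_ge a b _ _); rewrite lerDr.
by case: ifP => // _; exact: V_ge0.
Qed.

Let count_history a b k w : count a b (history Y k w) =
  (b - a) * (upcross a b (fun j => V (history Y j w)) k).2%:R.
Proof.
by rewrite /count size_history (upcross_eq _ _ (@path_history k w)).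
Qed.

(** Doob's upcrossing argument: the gain in [wealth_ge] is nondecreasing and dominated by a
    supermartingale. If [a < 0], the nonnegative [V] never comes down to [a]. *)
Lemma supermart_ae_upcross (a b : R) : a < b ->
  {ae P, forall w, exists m, forall k,
    ((upcross a b (fun j => V (history Y j w)) k).2 <= m)%N}.
Proof.
move=> ab; have [a0|a0] := leP 0 a; last first.
  apply: aeW => w; exists 0%N => k.
  have nle j : (V (history Y j w) <= a) = false.
    by apply/negbTE; rewrite -ltNge (lt_le_trans a0).
  suff -> : upcross a b (fun j => V (history Y j w)) k = (false, 0%N) by [].
  by elim: k => [|k IH] /=; rewrite ?IH nle.
have := tree_ae_bounded (@wealth_supermart a b)
  (fun s => count_wealth s a0 ab) (fun s t => count_mono s t ab).
apply: filterS => w [C hC]; exists (Num.truncn (C / (b - a))).+1 => k.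
rewrite -(ler_nat R); apply: le_trans (ltW (truncnS_gt _)).
by rewrite ler_pdivlMr ?subr_gt0// mulrC -count_history.
Qed.

Lemma supermart_ae_bounded :
  {ae P, forall w, exists C, forall k, V (history Y k w) <= C}.
Proof.
apply: (tree_negligible pi_ge0 cylinder_meas cylinderP) => e e0.
set a := V [::]; have a0 : 0 <= a by exact: V_ge0.
pose c := e / (a + 1); have c0 : 0 < c by rewrite divr_gt0// ltr_wpDl.
(* Since [V [::] = a], a unit is held from time 0; with this [b] a single sale brings [c * count] to
   1, so upcrossings also yield the maximal inequality. *)
pose b := a + c^-1; have ab : a < b by rewrite ltrDl invr_gt0.
exists (fun s => c * wealth a b (path s) (size s)), (fun s => c * count a b s).
split.
- exact: supermartZ (ltW c0) (@wealth_supermart a b).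
- by rewrite /= /c mulrAC ler_pdivrMr ?ltr_wpDl// ler_pM2l// lerDl.
- move=> s; case/andP: (count_wealth s a0 ab) => ? ?.
  by rewrite mulr_ge0 ?(ltW c0)//= ler_pM2l.
- by move=> s t; rewrite ler_pM2l// count_mono.
- move=> w /= nb; have [k bk] : exists k, b <= V (history Y k w).
    apply: contrapT => h; apply: nb; exists b => k.
    by rewrite leNgt; apply/negP => bk; apply: h; exists k; exact: ltW.
  exists k; rewrite count_history mulrA /b addrAC subrr add0r mulfV ?gt_eqF//.
  rewrite mul1r ler1n.
  have k0 : (0 < k)%N.
    by case: k bk => //; rewrite leNgt; move/negP; elim.
  apply: leq_ltn_trans (_ : _ <= _)%N (@upcross_sell _ a b ab _ 0 k k0 _ bk) => //.
Qed.

(** [V] converges since it is bounded with finitely many upcrossings of each rational interval.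
    Adding the accumulated drift to [V] still gives a supermartingale, so the drift has a finite sum
    and its terms tend to 0. *)
Theorem supermart_ae_cvg :
  {ae P, forall w, cvgn (fun k => V (history Y k w)) /\
                   res (history Y k w) @[k --> \oo] --> (0 : R)}.
Proof.
pose M s := \sum_(j < size s) res (take j s).
have M_rcons s t : M (rcons s t) = M s + res s.
  rewrite /M size_rcons big_ord_recr /= -cats1 takel_cat// take_size.
  by congr (_ + _); apply: eq_bigr => j _; rewrite takel_cat// ltnW.
have M0 s : 0 <= M s by exact: sumr_ge0.
have aeM : {ae P, forall w, exists C, forall k, M (history Y k w) <= C}.
  apply: (@tree_ae_bounded (fun s => V s + M s)).
  - move=> s; under eq_bigr do rewrite M_rcons mulrDr.
    rewrite big_split /= -mulr_suml pi_sum mul1r.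
    by have := V_decr s; lra.
  - by move=> s; rewrite M0 lerDr V_ge0.
  - by move=> s t; rewrite M_rcons lerDl.
have aeU : {ae P, forall w, forall a b : rat, a < b -> exists m, forall k,
    ((upcross (ratr a) (ratr b) (fun j => V (history Y j w)) k).2 <= m)%N}.
  (* Rational pairs are coded by natural numbers, so that countably many almost sure events are
     intersected. *)
  have : {ae P, forall w, forall i : nat,
      if (unpickle i : option (rat * rat)) is Some (a, b) then
      a < b -> exists m, forall k,
    ((upcross (ratr a) (ratr b) (fun j => V (history Y j w)) k).2 <= m)%N
    else True}.
    apply: ae_foralln => i; case: (unpickle i) => [[a b]|]; last exact: aeW.
    have [ab|ab] := boolP (a < b); last by apply: aeW.
    have ab' : ratr a < ratr b :> R by rewrite ltr_rat.
    by apply: filterS (supermart_ae_upcross ab') => w h _.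
  by apply: filterS => w h a b; have := h (pickle (a, b)); rewrite pickleK.
apply: filterS3 aeU supermart_ae_bounded aeM => w up [C VC] [C' MC]; split.
  apply: bounded_upcrossings_cvg up.
  by exists C => k; rewrite ger0_norm.
have -> : (fun k => res (history Y k w)) =
    telescope (fun k => M (history Y k w)).
  by apply/funext => k; rewrite /telescope /= historyS M_rcons addrAC subrr add0r.
have /cvg_ex[l cl] : cvgn (fun k => M (history Y k w)).
  apply: nondecreasing_is_cvgn.
    by apply/nondecreasing_seqP => k; rewrite historyS M_rcons lerDl.
  by exists C' => _ [k _ <-].
rewrite -(subrr l); apply: cvgB => //.
by have := cl; rewrite -(cvg_shiftS (fun k => M (history Y k w))).
Qed.

End SupermartingaleConvergence.

(** Supermartingale convergence applied to the indicator that [t] has not occurred since time [m]: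
    while it is 1, the drift past time [m] is [pi t > 0], yet almost surely the drift tends to 0. *)
Lemma ae_infinitely_often (R : realType) (T : finType) (pi : T -> R)
    d (Omega : measurableType d) (P : probability Omega R)
    (Y : nat -> Omega -> T) (t : T) :
  (forall u, 0 <= pi u) -> \sum_u pi u = 1 ->
  (forall s, measurable (cylinder Y s)) ->
  (forall s, P (cylinder Y s) = (\prod_(u <- s) pi u)%:E) ->
  0 < pi t ->
  {ae P, forall w, forall m : nat, exists2 k, (m <= k)%N & Y k w = t}.
Proof.
move=> pi0 pi1 mc Pc pit; apply: ae_foralln => m.
pose V s : R := (t \notin drop m s)%:R.
pose res s := if (size s < m)%N then 0 else pi t * V s.
have V0 s : 0 <= V s by exact: ler0n.
have res0 s : 0 <= res s by rewrite /res; case: ifP => // _; rewrite mulr_ge0.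
have decr s : \sum_u pi u * V (rcons s u) <= V s - res s.
  rewrite /res; case: ltnP => sm.
    rewrite subr0 /V drop_oversize ?(ltnW sm)//=.
    rewrite (eq_bigr pi) ?pi1// => u _.
    by rewrite drop_oversize ?size_rcons// mulr1.
  rewrite (bigD1 t)//= /V drop_rcons// mem_rcons inE eqxx mulr0 add0r.
  rewrite (_ : _ - _ = \sum_(u | u != t) pi u * (t \notin drop m s)%:R).
    apply: ler_sum => u ut; rewrite drop_rcons// mem_rcons inE eq_sym.
    by rewrite (negbTE ut).
  by rewrite -mulr_suml -{1}[X in X - _]mul1r -{1}pi1 (bigD1 t)//= mulrDl addrAC subrr add0r.
apply: filterS (supermart_ae_cvg pi0 pi1 mc Pc V0 res0 decr) => w [_ resw].
apply: contrapT => no.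
have noV k : V (history Y k w) = 1.
  rewrite /V (_ : t \notin _)//; apply/negP.
  rewrite /history /mkseq -map_drop drop_iota => /mapP[i].
  rewrite mem_iota => /andP[mi _] Yi; apply: no; exists i => //.
have /cvgrPdist_lt/(_ _ pit)[K _ /(_ (maxn K m))] := resw.
rewrite /= leq_maxl /res size_history ltnNge leq_maxr noV mulr1 sub0r normrN => /(_ isT).
by rewrite gtr0_norm// ltxx.
Qed.

(** * Independent identically distributed blocks *)

Section IndependentIdenticallyDistributed.
Context (R : realType) d (Omega : measurableType d) (P : probability Omega R).
Context (T : finType).

Lemma iid_comp (T0 : finType) (g : T0 -> T) (Z : nat -> Omega -> T0) :
  iid P Z -> iid P (fun k w => g (Z k w)).
Proof.
move=> [mZ idZ indZ]; split.
- by move=> k B; exact: (mZ k (g @^-1` B)).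
- by move=> k B; exact: (idZ k (g @^-1` B)).
- by move=> J B; exact: (indZ J (fun k => g @^-1` B k)).
Qed.

Variable Y : nat -> Omega -> T.
Hypothesis iidY : iid P Y.

Definition law t : R := fine (P [set w | Y 0%N w = t]).

Lemma lawE k t : P (Y k @^-1` [set t]) = (law t)%:E.
Proof.
by case: (iidY) => mY idY _; rewrite idY /law fineK// fin_num_measure//; exact: (mY 0%N [set t]).
Qed.

Lemma law_sum : \sum_t law t = 1.
Proof.
case: (iidY) => mY _ _; apply: EFin_inj; rewrite -sumEFin -(probability_setT P).
under eq_bigr do rewrite -(lawE 0%N).
rewrite (fsbig_seq _ _ (index_enum_uniq T)) -measure_fin_bigcup//.
- congr (P _); apply/seteqP; split => w //= _.
  by exists (Y 0%N w) => //=; rewrite mem_index_enum.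
- by move=> t u _ _ [w [/= -> ->]].
Qed.

Lemma iid_cylinder s : measurable (cylinder Y s) /\
  P (cylinder Y s) = (\prod_(t <- s) law t)%:E.
Proof.
case: (iidY) => mY idY indY.
case: s => [|t0 s0].
  rewrite (_ : cylinder Y [::] = setT); last by apply/seteqP; split.
  by split; [exact: measurableT|rewrite big_nil probability_setT].
move: (t0 :: s0) => s.
have -> : cylinder Y s = \bigcap_(k in [set` iota 0 (size s)])
    (Y k @^-1` [set nth t0 s k]).
  apply/seteqP; split => w /=.
    by move=> <- k /=; rewrite mem_iota size_history add0n => kn; rewrite nth_mkseq.
  move=> h; apply: (@eq_from_nth _ t0); rewrite size_history// => k ks.
  by rewrite nth_mkseq// (h k)//= mem_iota.
split; first by apply: fin_bigcap_measurable => // k _; exact: mY.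
rewrite (indY (iota 0 (size s)) (fun k => [set nth t0 s k])) ?iota_uniq//.
rewrite (eq_bigr (fun k => (law (nth t0 s k))%:E)); last by move=> k _; exact: lawE.
rewrite (big_nth t0) /index_iota subn0.
by elim: (iota _ _) => [|k r IH]; rewrite ?big_nil// !big_cons IH -EFinM.
Qed.

End IndependentIdenticallyDistributed.

(** * Convexity and limits *)

Section Convexity.
Context (R : realType).

Lemma convex_function_le (E : lmodType R) (f : E -> R) (t : R) (x y : E) :
  convex_function [set: E] f -> 0 <= t -> t <= 1 ->
  f (t *: x + (1 - t) *: y) <= t * f x + (1 - t) * f y.
Proof.
move=> cf t0 t1; have /= := cf (Itv01 t0 t1) x y.
by rewrite !in_setT => /(_ isT isT).
Qed.

Lemma convex_set_conv (E : lmodType R) (A : set E) (t : R) (x y : E) :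
  convex_set A -> A x -> A y -> 0 <= t -> t <= 1 ->
  A (t *: x + (1 - t) *: y).
Proof.
move=> cA Ax Ay t0 t1; have := cA x y (Itv01 t0 t1).
by rewrite !inE; apply.
Qed.

(** Convexity gives [f (a + c *: u) <= f a + |c| * M], where [M] bounds the increments of [f] at
    [a + u] and [a - u]; the sign of [c] selects the endpoint. *)
Lemma convex_segment_usc (E : lmodType R) (f : E -> R) (a u : E) (e : R) :
  convex_function [set: E] f -> 0 < e ->
  exists2 dlt, 0 < dlt & forall c, `|c| <= dlt -> f (a + c *: u) <= f a + e.
Proof.
move=> cf e0.
pose M := `|f (a + u) - f a| + `|f (a - u) - f a| + 1.
have M0 : 0 < M by rewrite ltr_wpDl// addr_ge0.
exists (Num.min 1 (e / M)); first by rewrite lt_min ltr01 divr_gt0.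
move=> c; rewrite le_min => /andP[c1 ce].
have {}ce : `|c| * M <= e by rewrite -ler_pdivlMr.
have c0 : 0 <= `|c| by [].
have Mp : f (a + u) - f a <= M.
  have := ler_norm (f (a + u) - f a); have : 0 <= `|f (a - u) - f a| by [].
  by rewrite /M; lra.
have Mm : f (a - u) - f a <= M.
  have := ler_norm (f (a - u) - f a); have : 0 <= `|f (a + u) - f a| by [].
  by rewrite /M; lra.
have [cp|cn] := leP 0 c.
  have -> : a + c *: u = `|c| *: (a + u) + (1 - `|c|) *: a.
    by rewrite ger0_norm// scalerDr scalerBl scale1r [RHS]addrC addrA subrK.
  apply: le_trans (convex_function_le _ _ cf c0 c1) _; nra.
have -> : a + c *: u = `|c| *: (a - u) + (1 - `|c|) *: a.
  by rewrite ltr0_norm// scalerDr scalerBl scale1r [RHS]addrC addrA subrK scaleNr scalerN opprK.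
apply: le_trans (convex_function_le _ _ cf c0 c1) _; nra.
Qed.

(** Coordinates are added one at a time: the new point is the midpoint of two points, one with twice
    the new displacement and one with twice the earlier ones, so half of the smaller radius
    works. *)
Lemma convex_usc m (f : 'cV[R]_m -> R) (a : 'cV[R]_m) (e : R) :
  convex_function [set: 'cV[R]_m] f -> 0 < e ->
  exists2 dlt, 0 < dlt & forall h : 'cV[R]_m,
    (forall j, `|h j 0| <= dlt) -> f (a + h) <= f a + e.
Proof.
move=> cf e0.
suff H (r : seq 'I_m) : exists2 dlt, 0 < dlt & forall h : 'cV[R]_m,
    (forall j, `|h j 0| <= dlt) ->
    f (a + \sum_(j <- r) h j 0 *: delta_mx j 0) <= f a + e.
  have [dlt d0 hd] := H (index_enum 'I_m); exists dlt => // h hh.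
  have := hd h hh; congr (f (a + _) <= _).
  by rewrite [RHS]matrix_sum_delta; apply: eq_bigr => i _; rewrite big_ord1.
elim: r => [|i r [d1 d10 IH]].
  by exists 1 => // h _; rewrite big_nil addr0 lerDl ltW.
have [d2 d20 hd2] := convex_segment_usc a (delta_mx i 0) cf e0.
exists (Num.min d1 d2 / 2); first by rewrite divr_gt0// lt_min d10.
move=> h hh; rewrite big_cons.
have hj j : `|(2 *: h) j 0| <= Num.min d1 d2.
  by rewrite mxE normrM gtr0_norm// mulrC -ler_pdivlMr.
have IH2 : f (a + \sum_(j <- r) (2 *: h) j 0 *: delta_mx j 0) <= f a + e.
  by apply: IH => j; apply: le_trans (hj j) _; rewrite ge_min lexx.
have I2 : f (a + (2 *: h) i 0 *: delta_mx i 0) <= f a + e.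
  by apply: hd2; apply: le_trans (hj i) _; rewrite ge_min lexx orbT.
have h0 : 0 <= 2^-1 :> R by rewrite invr_ge0.
have h1 : 2^-1 <= 1 :> R by rewrite invf_le1// ler1n.
have := convex_function_le (a + (2 *: h) i 0 *: delta_mx i 0)
  (a + \sum_(j <- r) (2 *: h) j 0 *: delta_mx j 0) cf h0 h1.
suff -> : 2^-1 *: (a + (2 *: h) i 0 *: delta_mx i 0) +
    (1 - 2^-1) *: (a + \sum_(j <- r) (2 *: h) j 0 *: delta_mx j 0) =
    a + (h i 0 *: delta_mx i 0 + \sum_(j <- r) h j 0 *: delta_mx j 0).
  by lra.
have -> : 1 - 2^-1 = 2^-1 :> R by lra.
rewrite -scalerDr addrACA.
have -> : a + a = 2 *: a by rewrite scaler_nat.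
have -> : \sum_(j <- r) (2 *: h) j 0 *: delta_mx j 0 =
    2 *: \sum_(j <- r) h j 0 *: delta_mx j 0 :> 'cV[R]_m.
  by rewrite scaler_sumr; apply: eq_bigr => j _; rewrite mxE scalerA.
by rewrite mxE -scalerA -!scalerDr scalerA mulVf ?scale1r// pnatr_eq0.
Qed.

(** Upper semicontinuity implies lower semicontinuity by reflection: [a] is the midpoint of [v k]
    and [a + (a - v k)], and at the latter [f] is eventually at most [f a + e / 2]. *)
Lemma convex_lsc m (f : 'cV[R]_m -> R) (a : 'cV[R]_m) (S : Type)
    (F : set_system S) (v : S -> 'cV[R]_m) (g : S -> R) (G : R) :
  ProperFilter F -> convex_function [set: 'cV[R]_m] f ->
  (forall j, v k j 0 @[k --> F] --> a j 0) ->
  (forall k, f (v k) <= g k) -> g @ F --> G -> f a <= G.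
Proof.
move=> PF cf va fg gG; apply/ler_addgt0Pr => e e0.
have e2 : 0 < e / 2 by rewrite divr_gt0.
have [dlt d0 hd] := convex_usc a cf e2.
have near_v : \forall k \near F, forall j, `|(a - v k) j 0| <= dlt.
  apply: filter_forall => j; have /cvgrPdist_le/(_ _ d0) := va j.
  by apply: filterS => k; rewrite !mxE.
have near_g : \forall k \near F, `|G - g k| < e / 2.
  by have /cvgrPdist_lt/(_ _ e2) := gG.
have [k [/hd hv]] := filter_ex (filterI near_v near_g).
rewrite ltr_norml => /andP[hg _].
have h0 : 0 <= 2^-1 :> R by rewrite invr_ge0.
have h1 : 2^-1 <= 1 :> R by rewrite invf_le1// ler1n.
have := convex_function_le (v k) (a + (a - v k)) cf h0 h1.
have -> : 2^-1 *: v k + (1 - 2^-1) *: (a + (a - v k)) = a.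
  have -> : 1 - 2^-1 = 2^-1 :> R by lra.
  have -> : a + (a - v k) = 2 *: a - v k by rewrite scaler_nat addrA.
  rewrite -scalerDr addrC subrK scalerA.
  by rewrite mulVf ?scale1r// pnatr_eq0.
by have := fg k; lra.
Qed.

End Convexity.

Section FilterLimits.
Context (R : realType) (S : Type) (F : set_system S) (FF : ProperFilter F).

Lemma sqr_dominated_cvg0 (a r : S -> R) c : 0 < c ->
  (forall k, c * a k ^+ 2 <= r k) -> r @ F --> (0 : R) -> a @ F --> (0 : R).
Proof.
move=> c0 ar /cvgrPdist_lt r0; apply/cvgrPdist_lt => e e0.
have ce : 0 < c * e ^+ 2 by rewrite mulr_gt0// exprn_gt0.
apply: filterS (r0 _ ce) => k; rewrite !sub0r !normrN => rk.
have : c * a k ^+ 2 < c * e ^+ 2.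
  by apply: le_lt_trans (ar k) (le_lt_trans (ler_norm _) rk).
by rewrite ltr_pM2l// -real_normK ?num_real// ltr_sqr ?nnegrE// ltW.
Qed.

Lemma cvg_col m (v : S -> 'cV[R]_m) (a : 'cV[R]_m) :
  (forall j, v k j 0 @[k --> F] --> a j 0) -> v @ F --> a.
Proof.
move=> va; apply/cvg_ballP => e e0.
have : \forall k \near F, forall j, `|a j 0 - v k j 0| < e.
  by apply: filter_forall => j; have /cvgrPdist_lt/(_ _ e0) := va j.
apply: filterS => k h; split=> // i j; rewrite ord1.
by rewrite -ball_normE; exact: h.
Qed.

Lemma cvg_sumr (I : finType) (P : pred I) (v : I -> S -> R) (a : I -> R) :
  (forall i, P i -> v i @ F --> a i) ->
  (fun k => \sum_(i | P i) v i k) @ F --> \sum_(i | P i) a i.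
Proof.
by move=> va; apply: cvg_big => //; exact: add_continuous.
Qed.

End FilterLimits.

(** A finite family in [S] with span of maximal dimension works, as a vector of [S] outside would
    raise the dimension. It is applied to displacements between saddle points. *)
Lemma finite_spanning_subset (K : fieldType) (vT : vectType K) (S : set vT) :
  exists l : seq vT, (forall v, v \in l -> S v) /\
    (forall v, S v -> v \in span l).
Proof.
pose dims := fun k => `[< exists l : seq vT, (forall v, v \in l -> S v) /\
  \dim (span l) = k >].
have dims0 : exists k, dims k.
  by exists 0%N; apply/asboolP; exists [::]; split=> //; rewrite span_nil dimv0.
have dims_le k : dims k -> (k <= \dim {:vT})%N.
  by move=> /asboolP[l [_ <-]]; apply: dimvS; exact: subvf.
case: (ex_maxnP dims0 dims_le) => k /asboolP[l [lS dl]] kmax.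
exists l; split=> // v Sv; rewrite -[_ \in _]negbK; apply/negP => nv.
have /kmax : dims (\dim (span (v :: l))).
  apply/asboolP; exists (v :: l); split=> // u; rewrite inE => /orP[/eqP ->//|].
  exact: lS.
rewrite leqNgt -dl => /negP; apply; rewrite ltn_neqAle.
have sub : (span l <= span (v :: l))%VS by rewrite span_cons addvSr.
rewrite dimvS// andbT; apply/negP => /eqP e; move/negP: nv; apply.
have /eqP -> : span l == span (v :: l) by rewrite eqEdim sub e leqnn.
by rewrite memv_span// mem_head.
Qed.

(** * One iteration of the algorithm *)

Section DotProduct.
Context (R : realType) (m : nat).
Implicit Types u v w : 'cV[R]_m.

Lemma dotE u v : dot u v = \sum_i u i 0 * v i 0.
Proof. by rewrite /dot mxE; apply: eq_bigr => i _; rewrite mxE. Qed.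

Lemma dotDr u v w : dot u (v + w) = dot u v + dot u w.
Proof. by rewrite /dot mulmxDr mxE. Qed.

Lemma dotC u v : dot u v = dot v u.
Proof. by rewrite !dotE; apply: eq_bigr => i _; rewrite mulrC. Qed.

Lemma dotZr a u v : dot u (a *: v) = a * dot u v.
Proof. by rewrite /dot -scalemxAr mxE. Qed.

Lemma dotDl u v w : dot (u + v) w = dot u w + dot v w.
Proof. by rewrite ![dot _ w]dotC dotDr. Qed.

Lemma dotZl a u v : dot (a *: u) v = a * dot u v.
Proof. by rewrite ![dot _ v]dotC dotZr. Qed.

Lemma dotNl u v : dot (- u) v = - dot u v.
Proof. by rewrite -scaleN1r dotZl mulN1r. Qed.

Lemma dot_sumr (I : finType) u (v : I -> 'cV[R]_m) :
  dot u (\sum_i v i) = \sum_i dot u (v i).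
Proof. by rewrite /dot mulmx_sumr summxE. Qed.

Lemma dot_ge0 u : 0 <= dot u u.
Proof. by rewrite dotE sumr_ge0// => i _; rewrite -expr2 sqr_ge0. Qed.

Lemma enorm_sqr u : enorm u ^+ 2 = dot u u.
Proof. by rewrite sqr_sqrtr// dot_ge0. Qed.

End DotProduct.

Lemma ge0_of_segment (R : realType) (Q C : R) : 0 <= C ->
  (forall t, 0 < t -> t <= 1 -> 0 <= t * Q + t ^+ 2 * C) -> 0 <= Q.
Proof.
move=> C0 h; rewrite leNgt; apply/negP => Q0.
(* This makes [t * C] at most [- Q / 2], so the negative linear term wins. *)
pose t := - Q / (2 * (C - Q)).
have CQ : 0 < 2 * (C - Q) by lra.
have tE : t * (2 * (C - Q)) = - Q by rewrite /t divfK// gt_eqF.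
have t0 : 0 < t by rewrite divr_gt0// oppr_gt0.
have t1 : t <= 1 by rewrite ler_pdivrMr//; lra.
have := h t t0 t1; rewrite expr2 -mulrA -mulrDr pmulr_rge0//; nra.
Qed.

(* First-order condition: compare y with y + t (x - y) and let t tend to 0. *)
Lemma prox_variational (R : realType) m k (S : set 'cV[R]_m)
    (g : 'cV[R]_m -> R) (A : 'M[R]_(k, m)) (c p : 'cV[R]_k) (beta : R)
    (y : 'cV[R]_m) :
  0 <= beta -> convex_set S ->
  (forall t u v, 0 <= t -> t <= 1 ->
     g (t *: u + (1 - t) *: v) <= t * g u + (1 - t) * g v) ->
  S y ->
  (forall x, S x ->
     g y - dot p (A *m y) + beta / 2 * enorm (A *m y + c) ^+ 2 <=
     g x - dot p (A *m x) + beta / 2 * enorm (A *m x + c) ^+ 2) ->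
  forall x, S x ->
    dot (p - beta *: (A *m y + c)) (A *m (x - y)) <= g x - g y.
Proof.
move=> b0 cS cg Sy ymin x Sx; rewrite -subr_ge0.
set r := A *m y + c; set dd := A *m (x - y).
apply: (@ge0_of_segment _ _ (beta / 2 * dot dd dd)).
  by rewrite mulr_ge0 ?dot_ge0// divr_ge0.
move=> t t0 t1; have St := convex_set_conv cS Sx Sy (ltW t0) t1.
have := ymin _ St; have := cg t x y (ltW t0) t1.
have -> : A *m (t *: x + (1 - t) *: y) = A *m y + t *: dd.
  rewrite /dd scalemxAr -mulmxDr; congr (A *m _).
  by rewrite scalerBr scalerBl scale1r addrCA.
have -> : A *m y + t *: dd + c = r + t *: dd by rewrite addrAC.
rewrite -/r; clearbody r dd.
rewrite !enorm_sqr !dotDr !dotDl !dotZr !dotZl (dotC dd r) dotNl dotZl.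
by nra.
Qed.

(** * Block vectors and decoupled constraint matrices *)

Section Blocks.
Context (R : realType) (N n : nat).

Definition of_blocks (b : 'I_N -> 'cV[R]_n) : 'cV[R]_(N * n) :=
  (mxvec (\matrix_(i, j) b i j 0))^T.

Lemma of_blocksE b i j : of_blocks b (mxvec_index i j) 0 = b i j 0.
Proof. by rewrite mxE mxvecE mxE. Qed.

Lemma block_of_blocks b i : block i (of_blocks b) = b i.
Proof. by apply/colP => j; rewrite mxE of_blocksE. Qed.

Lemma blockE i (x : 'cV[R]_(N * n)) j : block i x j 0 = x (mxvec_index i j) 0.
Proof. by rewrite mxE. Qed.

Lemma block_inj (x y : 'cV[R]_(N * n)) :
  (forall i, block i x = block i y) -> x = y.
Proof.
by move=> h; apply/colP; case/mxvec_indexP => i j; rewrite -!blockE h.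
Qed.

Lemma blockD i (x y : 'cV[R]_(N * n)) : block i (x + y) = block i x + block i y.
Proof. by apply/colP => j; rewrite !mxE. Qed.

Lemma blockZ i a (x : 'cV[R]_(N * n)) : block i (a *: x) = a *: block i x.
Proof. by apply/colP => j; rewrite !mxE. Qed.

Lemma prodX_convex (X : 'I_N -> set 'cV[R]_n) :
  (forall i, convex_set (X i)) -> convex_set (prodX X).
Proof.
move=> cX x y t; rewrite !inE => Xx Xy i.
have := cX i (block i x) (block i y) t; rewrite !inE => /(_ (Xx i) (Xy i)).
by congr (X i _); apply/colP => j; rewrite !mxE.
Qed.

Lemma sepF_convex (f : 'I_N -> 'cV[R]_n -> R) phi t x y :
  (forall i, convex_function [set: 'cV[R]_n] (f i)) -> 0 <= t -> t <= 1 ->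
  sepF f phi (t *: x + (1 - t) *: y) <=
  t * sepF f phi x + (1 - t) * sepF f phi y.
Proof.
move=> cf t0 t1; rewrite /sepF !mulr_sumr -big_split/=; apply: ler_sum => i _.
by rewrite blockD !blockZ convex_function_le.
Qed.

End Blocks.

Lemma mxvec_index_inj m n (i i' : 'I_m) (j j' : 'I_n) :
  mxvec_index i j = mxvec_index i' j' -> i = i' /\ j = j'.
Proof.
move=> e; have := @mxvecE int _ _ (delta_mx i' j') i j.
rewrite e mxvecE !mxE !eqxx /=.
by case: eqP => [->|_]; case: eqP => [->|_].
Qed.

(** Coordinates for the constraints: the absence of zero columns becomes surjectivity of [(bi, bj)],
    and the determinant of the diagonal [H] gives [h l != 0]. *)
Lemma decoupledP (R : realType) (N n W : nat) (D : 'M[R]_(W, N * n))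
    (H : 'M[R]_W) : decoupled D H ->
  exists (bi : 'I_W -> 'I_N) (bj : 'I_W -> 'I_n) (q h : 'I_W -> R),
  [/\ forall l i j,
        D l (mxvec_index i j) = if (bi l == i) && (bj l == j) then q l else 0,
      forall k l, H k l = if l == k then h k else 0,
      forall l, q l != 0, forall l, h l != 0 &
      forall i j, exists2 l, bi l = i & bj l = j].
Proof.
move=> [diagH unitH rowD colD].
have /choice[b Hb] l : exists ij : 'I_N * 'I_n,
    unique (fun c => D l c != 0) (mxvec_index ij.1 ij.2).
  by case: (rowD l); case/mxvec_indexP => i j u; exists (i, j).
have DE l i j : D l (mxvec_index i j) != 0 -> (b l).1 = i /\ (b l).2 = j.
  move=> Dn; have [_ /(_ _ Dn)] := Hb l.
  by move=> /mxvec_index_inj[-> ->].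
exists (fun l => (b l).1), (fun l => (b l).2).
exists (fun l => D l (mxvec_index (b l).1 (b l).2)), (fun l => H l l); split.
- move=> l i j; case: ifP => [/andP[/eqP <- /eqP <-]//|nb].
  apply/eqP; rewrite -[_ == 0]negbK; apply/negP => /DE[bi bj].
  by move: nb; rewrite bi bj !eqxx.
- move=> k l; have [->//|lk] := eqVneq l k.
  by move/is_diag_mxP : diagH; apply; rewrite eq_sym.
- by move=> l; case: (Hb l).
- move=> l; move: unitH; rewrite unitmxE det_trig ?is_diag_mx_is_trig//.
  by rewrite unitfE prodf_seq_neq0 => /allP/(_ l); rewrite mem_index_enum; apply.
- by move=> i j; have [l /DE[]] := colD (mxvec_index i j); exists l.
Qed.

(** * Optimality conditions of the updates *)

Section Step.
Context (R : realType) (N n W : nat).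
Variables (f : 'I_N -> 'cV[R]_n -> R) (X : 'I_N -> set 'cV[R]_n).
Variables (Z : set 'cV[R]_W) (D : 'M[R]_(W, N * n)) (H : 'M[R]_W) (beta : R).
Hypothesis f_convex : forall i, convex_function [set: 'cV[R]_n] (f i).
Hypothesis X_convex : forall i, convex_set (X i).
Hypothesis Z_convex : convex_set Z.
Hypothesis beta_gt0 : 0 < beta.
Variables (bi : 'I_W -> 'I_N) (bj : 'I_W -> 'I_n) (q h : 'I_W -> R).
(* The only nonzero entry of row l of D is q l, at coordinate bj l of block
   bi l; the diagonal of H is h. *)
Hypothesis DE : forall l i j,
  D l (mxvec_index i j) = if (bi l == i) && (bj l == j) then q l else 0.
Hypothesis HE : forall k l, H k l = if l == k then h k else 0.
Hypothesis q_neq0 : forall l, q l != 0.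
Hypothesis h_neq0 : forall l, h l != 0.
Hypothesis D_surj : forall i j, exists2 l, bi l = i & bj l = j.

Definition dx l (xi : 'cV[R]_n) : R := q l * xi (bj l) 0.

Lemma mulDE x l : (D *m x) l 0 = dx l (block (bi l) x).
Proof.
rewrite mxE (bigD1 (mxvec_index (bi l) (bj l)))//= DE !eqxx /= big1.
  by rewrite addr0 /dx blockE.
case/mxvec_indexP => i j ne; rewrite DE; case: ifP; last by rewrite mul0r.
by case/andP => /eqP bil /eqP bjl; rewrite bil bjl eqxx in ne.
Qed.

Lemma mulHE (z : 'cV[R]_W) l : (H *m z) l 0 = h l * z l 0.
Proof.
rewrite mxE (bigD1 l)//= HE eqxx big1 ?addr0// => k kl.
by rewrite HE (negbTE kl) mul0r.
Qed.

Lemma DsumE phi l i j : Dsum D phi l (mxvec_index i j) =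
  if i \in phi then D l (mxvec_index i j) else 0.
Proof.
rewrite /Dsum summxE.
have E k : Dcols D k l (mxvec_index i j) =
    if k == i then D l (mxvec_index i j) else 0.
  rewrite mxE; congr (if _ then _ else _); apply/existsP/eqP.
    by move=> [j' /eqP/mxvec_index_inj[]].
  by move=> ->; exists j.
under eq_bigr do rewrite E.
case: ifP => [iphi|niphi].
  rewrite (bigD1 i)//= eqxx big1 ?addr0// => k /andP[_ ki].
  by rewrite (negbTE ki).
rewrite big1// => k kphi; case: eqP => // ki.
by rewrite ki niphi in kphi.
Qed.

Lemma mulDsumE phi x l : (Dsum D phi *m x) l 0 =
  if bi l \in phi then dx l (block (bi l) x) else 0.
Proof.
rewrite -mulDE !mxE; case: ifP => bphi.
  apply: eq_bigr; case/mxvec_indexP => i j _; rewrite DsumE.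
  case: ifP => // iphi; rewrite DE; case: ifP => // /andP[/eqP bil _].
  by rewrite bil iphi in bphi.
apply: big1; case/mxvec_indexP => i j _; rewrite DsumE DE.
case: ifP => [iphi|_]; last by rewrite mul0r.
case: ifP => [/andP[/eqP bil _]|_]; last by rewrite mul0r.
by rewrite bil iphi in bphi.
Qed.

Lemma mulHsumE (psi : {set 'I_W}) (z : 'cV[R]_W) l : (Hsum H psi *m z) l 0 =
  if l \in psi then h l * z l 0 else 0.
Proof.
have E a b : Hsum H psi a b = if (a \in psi) && (b == a) then h a else 0.
  rewrite /Hsum summxE; case: ifP => [/andP[ap /eqP ->]|nab].
    rewrite (bigD1 a)//= mxE eqxx /= HE eqxx big1 ?addr0// => k /andP[_ ka].
    by rewrite mxE eq_sym (negbTE ka).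
  apply: big1 => k kp; rewrite mxE; case: ifP => // /andP[/eqP ak /eqP bk].
  by rewrite ak bk kp eqxx in nab.
rewrite mxE (bigD1 l)//= big1 ?addr0 => [|k kl].
  by rewrite E eqxx andbT; case: ifP => _; rewrite ?mul0r.
by rewrite E (negbTE kl) andbF mul0r.
Qed.

Lemma in_active (psi : {set 'I_W}) i :
  (i \in active D psi) = [exists l in psi, bi l == i].
Proof.
rewrite inE; apply/exists_inP/exists_inP => -[l lp].
  by move=> /existsP[j]; rewrite DE; case: ifP => [/andP[]|_]; rewrite ?eqxx//; exists l.
move=> /eqP <-; exists l => //; apply/existsP; exists (bj l).
by rewrite DE !eqxx /=.
Qed.

Lemma active_row (psi : {set 'I_W}) l : l \in psi -> bi l \in active D psi.
Proof. by move=> lp; rewrite in_active; apply/exists_inP; exists l. Qed.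

Lemma dx_blockB l i (x y : 'cV[R]_(N * n)) :
  dx l (block i (x - y)) = dx l (block i x) - dx l (block i y).
Proof. by rewrite /dx -mulrBr !mxE. Qed.

Lemma sub_scale_addE m (a : R) (u v w : 'cV[R]_m) l :
  (u - a *: (v + w)) l 0 = u l 0 - a * (v l 0 + w l 0).
Proof. by rewrite !mxE. Qed.

(* The first-order condition of the x-update for block i alone; it does not
   depend on the set of active blocks. *)
Definition x_optimal (z p : 'cV[R]_W) i xi : Prop :=
  X i xi /\ forall y, X i y ->
  \sum_(l | bi l == i) (p l 0 - beta * (dx l xi + h l * z l 0)) *
    (dx l y - dx l xi) <= f i y - f i xi.

(* The first-order condition of the z-update, in which p is the multiplier
   after the update: no knowledge of the previous iterate remains. *)
Definition z_optimal (psi : {set 'I_W}) (z p : 'cV[R]_W) : Prop :=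
  forall y, Z y -> \sum_(l in psi) p l 0 * (h l * (y l 0 - z l 0)) <= 0.

(** Each point is tested against the other; the sum of the two inequalities leaves only the penalty
    squares, and every coordinate of the block is seen by some row. *)
Lemma x_optimal_uniq z p i xi xi' :
  x_optimal z p i xi -> x_optimal z p i xi' -> xi = xi'.
Proof.
move=> [Xi oi] [Xi' oi'].
have := lerD (oi _ Xi') (oi' _ Xi); rewrite addrA subrK subrr.
rewrite -big_split /=.
rewrite (eq_bigr (fun l => beta * (dx l xi' - dx l xi) ^+ 2)); last first.
  by move=> l _; ring.
rewrite -mulr_sumr pmulr_rle0// => s0.
have s1 : \sum_(l | bi l == i) (dx l xi' - dx l xi) ^+ 2 == 0.
  by rewrite eq_le s0 sumr_ge0// => l _; rewrite sqr_ge0.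
move: s1; rewrite psumr_eq0; last by move=> l _; rewrite sqr_ge0.
move=> /allP al; apply/colP => j; have [l bil bjl] := D_surj i j.
have := al l (mem_index_enum _); rewrite bil eqxx /= sqrf_eq0 subr_eq0.
by rewrite /dx bjl => /eqP/(mulfI (q_neq0 l)) ->.
Qed.

Section OneStep.
Variables (psi : {set 'I_W}) (x x' : 'cV[R]_(N * n)) (z p z' p' : 'cV[R]_W).
Hypothesis stepP : admm_step f X Z D H beta (active D psi) psi x z p x' z' p'.

Lemma step_z_in : Z z'.
Proof. by case: stepP => _ [[? _] _] _. Qed.

Lemma step_x_optimal i :
  i \in active D psi -> x_optimal z p i (block i x').
Proof.
move=> ia; case: stepP => -[[Xx' xmin] _] _ _; split=> [|y Xy]; first exact: Xx'.
(* Moving only block [i] isolates its rows in the joint first-order condition. *)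
pose y' := of_blocks (fun k => if k == i then y else block k x').
have yk k : block k y' = if k == i then y else block k x' by rewrite block_of_blocks.
have Xy' : prodX X y' by move=> k; rewrite yk; case: eqP => [->|].
have := prox_variational (ltW beta_gt0) (prodX_convex X_convex)
  (fun t u v => @sepF_convex _ _ _ f (active D psi) t u v f_convex) Xx' xmin Xy'.
congr (_ <= _).
  rewrite dotE (bigID (fun l => bi l == i))/= [X in _ + X]big1 ?addr0.
    apply: eq_bigr => l /eqP bil.
    by rewrite sub_scale_addE mulHE !mulDsumE bil ia dx_blockB yk eqxx.
  move=> l bil; rewrite mulDsumE dx_blockB yk (negbTE bil) subrr.
  by case: ifP => _; rewrite mulr0.
rewrite /sepF -sumrB (bigD1 i)//= yk eqxx big1 ?addr0// => k /andP[_ ki].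
by rewrite yk (negbTE ki) subrr.
Qed.

Lemma step_x_inactive i : i \notin active D psi -> block i x' = block i x.
Proof. by case: stepP => -[_ hx] _ _; exact: hx. Qed.

Lemma step_z_inactive l : l \notin psi -> z' l 0 = z l 0.
Proof. by case: stepP => _ [_ hz] _; exact: hz. Qed.

Lemma step_pE l : p' l 0 = if l \in psi
  then p l 0 - beta * (dx l (block (bi l) x') + h l * z' l 0) else p l 0.
Proof.
case: stepP => _ _ ->.
have -> : (p - beta *: restr psi (Dsum D (active D psi) *m x' + Hsum H psi *m z')) l 0
    = p l 0 - beta * (if l \in psi then
       (Dsum D (active D psi) *m x') l 0 + (Hsum H psi *m z') l 0 else 0).
  by move: (_ *m x') (_ *m z') => u v; rewrite !mxE.
rewrite mulDsumE mulHsumE; case: (boolP (l \in psi)) => lp.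
  by rewrite active_row.
by rewrite mulr0 subr0.
Qed.

(** The multiplier in the first-order condition of the z-update is, on [psi], exactly the updated
    [p']. *)
Lemma step_z_optimal : z_optimal psi z' p'.
Proof.
case: (stepP) => _ [[Zz' zmin] _] _ y Zy.
have zmin' v : Z v -> (fun=> 0) z' - dot p (Hsum H psi *m z')
    + beta / 2 * enorm (Hsum H psi *m z' + Dsum D (active D psi) *m x') ^+ 2 <=
    (fun=> 0) v - dot p (Hsum H psi *m v)
    + beta / 2 * enorm (Hsum H psi *m v + Dsum D (active D psi) *m x') ^+ 2.
  by move=> Zv; rewrite !sub0r; exact: zmin.
have cvx0 (t : R) (u v : 'cV[R]_W) : 0 <= t -> t <= 1 ->
    (fun=> 0) (t *: u + (1 - t) *: v) <= t * (fun=> 0) u + (1 - t) * (fun=> 0) v :> R.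
  by rewrite !mulr0 addr0.
have := prox_variational (ltW beta_gt0) Z_convex cvx0 Zz' zmin' Zy.
rewrite subrr; congr (_ <= _).
rewrite dotE [RHS]big_mkcond/=; apply: eq_bigr => l _.
rewrite sub_scale_addE !mulHsumE step_pE mulDsumE.
case: (boolP (l \in psi)) => lp; last by rewrite mulr0.
rewrite active_row// [_ + dx _ _]addrC; congr (_ * (_ * _)).
by rewrite !mxE.
Qed.

End OneStep.

Lemma step_determined (psi : {set 'I_W}) (x x1 x2 : 'cV[R]_(N * n))
    (z p z1 p1 z2 p2 : 'cV[R]_W) :
  admm_step f X Z D H beta (active D psi) psi x z p x1 z1 p1 ->
  admm_step f X Z D H beta (active D psi) psi x z p x2 z2 p2 ->
  [/\ x1 = x2, z1 = z2 & p1 = p2].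
Proof.
move=> s1 s2.
have ex : x1 = x2.
  apply: block_inj => i; have [ia|ina] := boolP (i \in active D psi).
    exact: x_optimal_uniq (step_x_optimal s1 ia) (step_x_optimal s2 ia).
  by rewrite (step_x_inactive s1 ina) (step_x_inactive s2 ina).
have ez : z1 = z2.
  (* As the x-updates agree, [p1 - p2] equals [- beta * h l * (z1 - z2)] on [psi], so the sum of the
     two conditions is a sum of squares. *)
  have := lerD (step_z_optimal s1 (step_z_in s2)) (step_z_optimal s2 (step_z_in s1)).
  rewrite addr0 -big_split /=.
  rewrite (eq_bigr (fun l => beta * (h l * (z2 l 0 - z1 l 0)) ^+ 2)); last first.
    by move=> l lp; rewrite (step_pE s1) (step_pE s2) lp ex; ring.
  rewrite -mulr_sumr pmulr_rle0// => s0.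
  have : \sum_(l in psi) (h l * (z2 l 0 - z1 l 0)) ^+ 2 == 0.
    by rewrite eq_le s0 sumr_ge0// => l _; rewrite sqr_ge0.
  rewrite psumr_eq0; last by move=> l _; rewrite sqr_ge0.
  move=> /allP al; apply/colP => l; have [lp|lnp] := boolP (l \in psi).
    have := al l (mem_index_enum _); rewrite lp /= sqrf_eq0 mulf_eq0.
    by rewrite (negbTE (h_neq0 l)) subr_eq0 => /eqP.
  by rewrite (step_z_inactive s1 lnp) (step_z_inactive s2 lnp).
by split=> //; apply/colP => l; rewrite (step_pE s1) (step_pE s2) ex ez.
Qed.

(** * Saddle points and the decrease under a synchronous step *)

Lemma sepFT (x : 'cV[R]_(N * n)) :
  sepF f [set: 'I_N]%SET x = \sum_i f i (block i x).
Proof. by apply: eq_bigl => i; rewrite inE. Qed.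

Lemma constraintE (x : 'cV[R]_(N * n)) (z : 'cV[R]_W) l :
  (D *m x + H *m z) l 0 = dx l (block (bi l) x) + h l * z l 0.
Proof. by rewrite -mulDE -mulHE [LHS]mxE. Qed.

Lemma saddle_feasible xs zs ps : saddle_point f X Z D H xs zs ps ->
  forall l, dx l (block (bi l) xs) + h l * zs l 0 = 0.
Proof.
move=> [Xs Zs sad] l; set r := D *m xs + H *m zs.
(* Testing the multiplier [ps - r] yields [dot r r <= 0]. *)
have [+ _] := sad xs zs (ps - r) Xs Zs.
rewrite /lagrangian lerD2l lerN2 -/r dotDl dotNl lerDl oppr_ge0 => r0.
have {}r0 : dot r r == 0 by rewrite eq_le r0 dot_ge0.
move: r0; rewrite dotE psumr_eq0; last by move=> k _; rewrite -expr2 sqr_ge0.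
move=> /allP/(_ l (mem_index_enum _))/=.
by rewrite mulf_eq0 orbb constraintE => /eqP.
Qed.

Lemma saddle_x_min xs zs ps : saddle_point f X Z D H xs zs ps ->
  forall x, prodX X x ->
  \sum_l ps l 0 * (dx l (block (bi l) x) - dx l (block (bi l) xs)) <=
  \sum_i (f i (block i x) - f i (block i xs)).
Proof.
move=> sad x Xx; have fs := saddle_feasible sad.
case: sad => Xs Zs sad; have [_] := sad x zs ps Xx Zs.
rewrite /lagrangian !sepFT.
rewrite sumrB !dotE.
rewrite [X in _ - X <= _]big1; last by move=> l _; rewrite constraintE fs mulr0.
rewrite (eq_bigr (fun l => ps l 0 * (dx l (block (bi l) x) - dx l (block (bi l) xs)))).
  by lra.
move=> l _; rewrite constraintE; congr (_ * _).
by have := fs l; lra.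
Qed.

Lemma saddle_z_min xs zs ps : saddle_point f X Z D H xs zs ps ->
  forall z, Z z -> \sum_l ps l 0 * (h l * (z l 0 - zs l 0)) <= 0.
Proof.
move=> sad z Zz; have fs := saddle_feasible sad.
case: sad => Xs Zs sad; have [_] := sad xs z ps Xs Zz.
rewrite /lagrangian lerD2l lerN2 !dotE => le.
apply: le_trans (_ : _ - 0 <= _); last first.
  rewrite subr_le0; apply: le_trans le _.
  by rewrite big1// => l _; rewrite constraintE fs mulr0.
rewrite subr0 ler_sum// => l _; rewrite constraintE.
by rewrite le_eqVlt; apply/orP; left; apply/eqP; congr (_ * _); have := fs l; lra.
Qed.

(** At a feasible point the penalty drops out of [x_optimal], so summing over blocks gives the
    first-order condition of the Lagrangian itself. *)
Lemma saddle_intro (x : 'cV[R]_(N * n)) (z p : 'cV[R]_W) :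
  Z z -> (forall l, dx l (block (bi l) x) + h l * z l 0 = 0) ->
  (forall i, x_optimal z p i (block i x)) ->
  (forall y, Z y -> \sum_l p l 0 * (h l * (y l 0 - z l 0)) <= 0) ->
  saddle_point f X Z D H x z p.
Proof.
move=> Zz fs xo zo.
have c0 : D *m x + H *m z = 0 by apply/colP => l; rewrite constraintE fs mxE.
split=> //; first by move=> i; case: (xo i).
move=> x1 z1 p1 Xx1 Zz1; rewrite /lagrangian c0.
have d0 u : dot u (0 : 'cV[R]_W) = 0.
  by rewrite dotE big1// => l _; rewrite mxE mulr0.
rewrite !d0 lexx; split=> //.
rewrite !sepFT.
have := zo _ Zz1.
have : \sum_l p l 0 * (dx l (block (bi l) x1) - dx l (block (bi l) x)) <=
  \sum_i (f i (block i x1) - f i (block i x)).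
  rewrite (partition_big bi predT)//=; apply: ler_sum => i _.
  case: (xo i) => _ /(_ _ (Xx1 i)); congr (_ <= _).
  by apply: eq_bigr => l /eqP <-; rewrite fs mulr0 subr0.
rewrite sumrB dotE => e1 e2.
suff : \sum_l p l 0 * (D *m x1 + H *m z1) l 0 =
    \sum_l p l 0 * (dx l (block (bi l) x1) - dx l (block (bi l) x)) +
    \sum_l p l 0 * (h l * (z1 l 0 - z l 0)) by lra.
rewrite -big_split/=; apply: eq_bigr => l _; rewrite constraintE -mulrDr.
by congr (_ * _); have := fs l; lra.
Qed.

Definition gap (zs ps z p : 'cV[R]_W) l : R :=
  (p l 0 - ps l 0) ^+ 2 / beta + beta * (h l * (z l 0 - zs l 0)) ^+ 2.

(** The x- and z-conditions of the step and of the saddle point are tested at each other's points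
    and added. The [f i] cancel, and the decrease minus the residual is exactly -2 times the
    resulting sum. *)
Lemma gap_decrease xs zs ps z p (y : 'cV[R]_(N * n)) (v mu : 'cV[R]_W) :
  saddle_point f X Z D H xs zs ps ->
  Z v -> (forall i, x_optimal z p i (block i y)) ->
  (forall l, mu l 0 = p l 0 - beta * (dx l (block (bi l) y) + h l * v l 0)) ->
  \sum_l mu l 0 * (h l * (zs l 0 - v l 0)) <= 0 ->
  \sum_l gap zs ps v mu l <= \sum_l gap zs ps z p l -
    beta * \sum_l (dx l (block (bi l) y) + h l * z l 0) ^+ 2.
Proof.
move=> sad Zv xo muE zo; have fs := saddle_feasible sad.
have Xy : prodX X y by move=> i; case: (xo i).
have e1 := saddle_x_min sad Xy.
have e2 := saddle_z_min sad Zv.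
have e3 : \sum_l (p l 0 - beta * (dx l (block (bi l) y) + h l * z l 0)) *
    (dx l (block (bi l) xs) - dx l (block (bi l) y)) <=
    \sum_i (f i (block i xs) - f i (block i y)).
  rewrite (partition_big bi predT)//=; apply: ler_sum => i _.
  case: sad => Xs _ _; case: (xo i) => _ /(_ _ (Xs i)); congr (_ <= _).
  by apply: eq_bigr => l /eqP <-.
have e4 : \sum_i (f i (block i xs) - f i (block i y)) =
    - \sum_i (f i (block i y) - f i (block i xs)).
  by rewrite -sumrN; apply: eq_bigr => i _; rewrite opprB.
suff : \sum_l gap zs ps z p l - beta * \sum_l (dx l (block (bi l) y) + h l * z l 0) ^+ 2
    - \sum_l gap zs ps v mu l = - 2 * (
    \sum_l (p l 0 - beta * (dx l (block (bi l) y) + h l * z l 0)) *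
       (dx l (block (bi l) xs) - dx l (block (bi l) y)) +
    \sum_l ps l 0 * (dx l (block (bi l) y) - dx l (block (bi l) xs)) +
    \sum_l ps l 0 * (h l * (v l 0 - zs l 0)) +
    \sum_l mu l 0 * (h l * (zs l 0 - v l 0))) by lra.
rewrite mulr_sumr -!sumrB -!big_split/= mulr_sumr; apply: eq_bigr => l _.
have -> : dx l (block (bi l) xs) = - (h l * zs l 0) by have := fs l; lra.
rewrite /gap muE; field.
by rewrite gt_eqF.
Qed.

(** * The Lyapunov function on the tree of histories *)

(* The blocks of the partition are indexed by T, block tl l contains l, and
   (xs s, zs s, ps s) is the state reached after the history s. *)
Section Tree.
Context (T : finType).
Variables (blk : T -> {set 'I_W}) (tl : 'I_W -> T) (pi : T -> R).
Hypothesis blkE : forall t l, (l \in blk t) = (t == tl l).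
Hypothesis pi_gt0 : forall t, 0 < pi t.
Hypothesis pi_sum : \sum_t pi t = 1.
Hypothesis Z_prod : forall y : 'cV[R]_W,
  (forall t, exists2 y', Z y' & forall l, l \in blk t -> y' l 0 = y l 0) -> Z y.
Variables (xs : seq T -> 'cV[R]_(N * n)) (zs ps : seq T -> 'cV[R]_W).
Hypothesis x0_in : prodX X (xs [::]).
Hypothesis steps : forall s t,
  admm_step f X Z D H beta (active D (blk t)) (blk t) (xs s) (zs s) (ps s)
    (xs (rcons s t)) (zs (rcons s t)) (ps (rcons s t)).

(* y is the outcome of updating all the blocks of x at once after s. *)
Definition full_update s (y : 'cV[R]_(N * n)) : Prop :=
  (forall i, x_optimal (zs s) (ps s) i (block i y)) /\
  (forall t i, i \in active D (blk t) ->
     block i (xs (rcons s t)) = block i y).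

Lemma active_tl i (j : 'I_n) : exists t, i \in active D (blk t).
Proof.
have [l <- _] := D_surj i j; exists (tl l).
by apply: active_row; rewrite blkE.
Qed.

(** Each block is taken from a step that activates it; by uniqueness all such steps give the same
    block. *)
Lemma full_update_ex : exists y, forall s, full_update s (y s).
Proof.
suff /choice[y yP] : forall s, exists y, full_update s y by exists y.
move=> s.
have /choice[b bP] i : exists b : 'cV[R]_n, x_optimal (zs s) (ps s) i b.
  (* A block that is never active has dimension n = 0. *)
  have [[j]|noj] := pselect (inhabited 'I_n).
    have [t /(step_x_optimal (steps s t))] := active_tl i j.
    by exists (block i (xs (rcons s t))).
  exists (block i (xs [::])); split=> // y _.
  rewrite big1; last by move=> l _; case: noj; split; exact: bj l.
  rewrite (_ : y = block i (xs [::])) ?subrr//.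
  by apply/colP => j; case: noj.
exists (of_blocks b); split=> [i|t i ia]; rewrite block_of_blocks //.
exact: x_optimal_uniq (step_x_optimal (steps s t) ia) (bP i).
Qed.

Variable y : seq T -> 'cV[R]_(N * n).
Hypothesis yP : forall s, full_update s (y s).

Definition residual s : R :=
  beta * \sum_l (dx l (block (bi l) (y s)) + h l * zs s l 0) ^+ 2.

(* The weights cancel the probability that coordinate l is updated. *)
Definition lyapunov (zo po : 'cV[R]_W) (z p : 'cV[R]_W) : R :=
  \sum_l (pi (tl l))^-1 * gap zo po z p l.

Lemma residual_ge0 s : 0 <= residual s.
Proof.
by rewrite mulr_ge0 ?(ltW beta_gt0)// sumr_ge0// => l _; rewrite sqr_ge0.
Qed.

Lemma gap_ge0 zo po z p l : 0 <= gap zo po z p l.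
Proof.
by apply: addr_ge0; [apply: divr_ge0|apply: mulr_ge0];
  rewrite ?sqr_ge0 ?(ltW beta_gt0).
Qed.

Lemma lyapunov_ge0 zo po z p : 0 <= lyapunov zo po z p.
Proof.
by rewrite sumr_ge0// => l _; rewrite mulr_ge0 ?gap_ge0// invr_ge0 ltW.
Qed.

Lemma lyapunov_decrease xo zo po s : saddle_point f X Z D H xo zo po ->
  \sum_t pi t * lyapunov zo po (zs (rcons s t)) (ps (rcons s t)) <=
  lyapunov zo po (zs s) (ps s) - residual s.
Proof.
move=> sad.
(* The synchronous step is assembled by reading each coordinate off the branch that updates it;
   [Z_prod] keeps [v] in [Z]. *)
pose v : 'cV[R]_W := \col_l zs (rcons s (tl l)) l 0.
pose mu : 'cV[R]_W := \col_l ps (rcons s (tl l)) l 0.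
have vE t l : l \in blk t -> zs (rcons s t) l 0 = v l 0.
  by rewrite blkE => /eqP ->; rewrite mxE.
have muE t l : l \in blk t -> ps (rcons s t) l 0 = mu l 0.
  by rewrite blkE => /eqP ->; rewrite mxE.
have in_tl l : l \in blk (tl l) by rewrite blkE.
have Zv : Z v.
  apply: Z_prod => t; exists (zs (rcons s t)); first exact: step_z_in (steps s t).
  by move=> l /vE.
have mu_upd l : mu l 0 =
    ps s l 0 - beta * (dx l (block (bi l) (y s)) + h l * v l 0).
  rewrite -(muE (tl l))// (step_pE (steps s (tl l))) in_tl vE//.
  by rewrite (yP s).2// active_row.
have zopt : \sum_l mu l 0 * (h l * (zo l 0 - v l 0)) <= 0.
  rewrite (partition_big tl predT)//=; apply: sumr_le0 => t _.
  case: sad => _ Zzo _.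
  have := step_z_optimal (steps s t) Zzo; congr (_ <= _).
  apply: eq_big => l; first by rewrite blkE eq_sym.
  by move=> lt; rewrite vE ?muE.
have := gap_decrease sad Zv (yP s).1 mu_upd zopt.
rewrite -/(residual s) => dec.
(* Coordinate [l] takes its synchronous value with probability [pi (tl l)], which its weight
   cancels, and is unchanged otherwise. *)
have -> : \sum_t pi t * lyapunov zo po (zs (rcons s t)) (ps (rcons s t)) =
    lyapunov zo po (zs s) (ps s) +
    (\sum_l gap zo po v mu l - \sum_l gap zo po (zs s) (ps s) l).
  under eq_bigr do rewrite mulr_sumr.
  rewrite exchange_big /= -sumrB -big_split/=; apply: eq_bigr => l _.
  rewrite (bigD1 (tl l))//= mulrA mulfV ?gt_eqF// mul1r.
  have -> : gap zo po (zs (rcons s (tl l))) (ps (rcons s (tl l))) l =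
      gap zo po v mu l by rewrite /gap (vE (tl l))// (muE (tl l)).
  rewrite (eq_bigr (fun t => pi t * ((pi (tl l))^-1 * gap zo po (zs s) (ps s) l))); last first.
    move=> t tl_ne; have lnt : l \notin blk t by rewrite blkE.
    rewrite /gap (step_z_inactive (steps s t) lnt) (step_pE (steps s t)).
    by rewrite (negbTE lnt).
  rewrite -mulr_suml (_ : \sum_(t | t != tl l) pi t = 1 - pi (tl l)).
    by field; rewrite gt_eqF.
  by rewrite -pi_sum [in RHS](bigD1 (tl l))//= addrAC subrr add0r.
by lra.
Qed.

(** The condition only involves [z] and [p] on [blk t], and these coordinates stay frozen until [t]
    is next active. *)
Lemma z_optimal_visited s t : t \in s -> z_optimal (blk t) (zs s) (ps s).
Proof.
elim/last_ind: s => // s u IH; rewrite mem_rcons inE.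
have [-> _|tu /= ts] := eqVneq t u; first exact: step_z_optimal (steps s u).
move=> v Zv; have := IH ts _ Zv; congr (_ <= _); apply: eq_bigr => l lt.
have lnu : l \notin blk u by move: lt; rewrite !blkE => /eqP <-; rewrite eq_sym.
by rewrite (step_z_inactive (steps s u) lnu) (step_pE (steps s u)) (negbTE lnu).
Qed.

(** * Convergence along a path of active blocks *)

Hypothesis X_closed : forall i, closed (X i).
Hypothesis Z_closed : closed Z.
Variable u : nat -> T.
Hypothesis u_io : forall t m, exists2 k, (m <= k)%N & u k = t.

Let x_ k := xs (mkseq u k).
Let z_ k := zs (mkseq u k).
Let p_ k := ps (mkseq u k).
Let y_ k := y (mkseq u k).

Let step_ k :
  admm_step f X Z D H beta (active D (blk (u k))) (blk (u k)) (x_ k) (z_ k) (p_ k)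
    (x_ k.+1) (z_ k.+1) (p_ k.+1).
Proof. by rewrite /x_ /z_ /p_ mkseqS; exact: steps. Qed.

Hypothesis res_cvg0 : residual (mkseq u k) @[k --> \oo] --> (0 : R).

Lemma primal_residual_cvg0 l :
  dx l (block (bi l) (y_ k)) + h l * z_ k l 0 @[k --> \oo] --> (0 : R).
Proof.
apply: sqr_dominated_cvg0 beta_gt0 _ res_cvg0 => k.
rewrite /residual ler_pM2l// (bigD1 l)//= lerDl; apply: sumr_ge0 => j _; exact: sqr_ge0.
Qed.

Lemma eventually_z_optimal : \forall k \near \oo,
  Z (z_ k) /\ forall v, Z v -> \sum_l p_ k l 0 * (h l * (v l 0 - z_ k l 0)) <= 0.
Proof.
have visit : \forall k \near \oo, forall t, t \in mkseq u k.
  apply: filter_forall => t; have [j _ <-] := u_io t 0; exists j.+1 => //= k jk.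
  by apply/mapP; exists j => //; rewrite mem_iota.
have Zk : \forall k \near \oo, Z (z_ k).
  by exists 1%N => // -[//|k] _; exact: step_z_in (step_ k).
apply: filterS2 visit Zk => k vk Zk; split=> // v Zv.
rewrite (partition_big tl predT)//=; apply: sumr_le0 => t _.
have := z_optimal_visited (vk t) Zv; congr (_ <= _).
by apply: eq_bigl => l; rewrite blkE eq_sym.
Qed.

(** With a vanishing residual, [z] determines the limit of every coordinate of [y] through a row
    that contains it. The filter [F] covers both an ultrafilter and [\oo]. *)
Lemma cvg_y (F : set_system nat) (z : 'cV[R]_W) : ProperFilter F -> \oo `<=` F ->
  (forall l, z_ k l 0 @[k --> F] --> z l 0) ->
  exists yo : 'cV[R]_(N * n),
    (forall c, y_ k c 0 @[k --> F] --> yo c 0) /\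
    (forall l, dx l (block (bi l) yo) + h l * z l 0 = 0).
Proof.
move=> PF sF cz.
have cy l : y_ k (mxvec_index (bi l) (bj l)) 0 @[k --> F] --> - (h l * z l 0) / q l.
  have -> : (fun k => y_ k (mxvec_index (bi l) (bj l)) 0) =
     (fun k => ((dx l (block (bi l) (y_ k)) + h l * z_ k l 0) - h l * z_ k l 0) / q l).
    by apply/funext => k; rewrite addrK /dx blockE mulrAC mulfV// mul1r.
  apply: cvgMl; rewrite -[X in _ --> X]sub0r; apply: cvgB.
    by apply: cvg_trans (primal_residual_cvg0 l); exact: cvg_app sF.
  by apply: cvgMr; exact: cz.
have /choice[yo yoP] (c : 'I_(N * n)) : exists a : R, y_ k c 0 @[k --> F] --> a.
  case/mxvec_indexP: c => i j; have [l <- <-] := D_surj i j.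
  by exists (- (h l * z l 0) / q l).
exists (\col_c yo c); split=> [c|l]; first by rewrite mxE.
rewrite /dx blockE mxE.
have <- := cvg_unique (@Rhausdorff R) (cy l) (yoP (mxvec_index (bi l) (bj l))).
by rewrite mulrCA mulfV// mulr1 addNr.
Qed.

Lemma lyapunov_dominates (zo po z p : 'cV[R]_W) l :
  (beta * pi (tl l))^-1 * (p l 0 - po l 0) ^+ 2 <= lyapunov zo po z p /\
  beta * h l ^+ 2 / pi (tl l) * (z l 0 - zo l 0) ^+ 2 <= lyapunov zo po z p.
Proof.
have w0 := pi_gt0 (tl l).
have : (pi (tl l))^-1 * gap zo po z p l <= lyapunov zo po z p.
  rewrite /lyapunov (bigD1 l)//= lerDl sumr_ge0// => k _.
  by rewrite mulr_ge0 ?gap_ge0// invr_ge0 ltW.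
have e1 : 0 <= (beta * pi (tl l))^-1 * (p l 0 - po l 0) ^+ 2.
  by apply: mulr_ge0; rewrite ?sqr_ge0// invr_ge0 ltW// mulr_gt0.
have e2 : 0 <= beta * h l ^+ 2 / pi (tl l) * (z l 0 - zo l 0) ^+ 2.
  apply: mulr_ge0; rewrite ?sqr_ge0//; apply: divr_ge0; last exact: ltW.
  by apply: mulr_ge0; rewrite ?sqr_ge0// ltW.
have -> : (pi (tl l))^-1 * gap zo po z p l =
    (beta * pi (tl l))^-1 * (p l 0 - po l 0) ^+ 2 +
    beta * h l ^+ 2 / pi (tl l) * (z l 0 - zo l 0) ^+ 2.
  by rewrite /gap; field; rewrite !gt_eqF.
by split; lra.
Qed.

Let lyap_const l : 0 < (beta * pi (tl l))^-1 /\
  0 < beta * h l ^+ 2 / pi (tl l).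
Proof.
have w0 := pi_gt0 (tl l); split; first by rewrite invr_gt0 mulr_gt0.
by apply: divr_gt0 => //; apply: mulr_gt0 => //; rewrite exprn_even_gt0//= h_neq0.
Qed.

Lemma cvg_of_lyapunov0 (zo po : 'cV[R]_W) :
  lyapunov zo po (z_ k) (p_ k) @[k --> \oo] --> (0 : R) ->
  (forall l, z_ k l 0 @[k --> \oo] --> zo l 0) /\
  (forall l, p_ k l 0 @[k --> \oo] --> po l 0).
Proof.
move=> c0; split=> l; have [c1 c2] := lyap_const l.
  apply: (@cvg_sub0 _ _ _ _ _ _ (cst (zo l 0))); last exact: cvg_cst.
  apply: sqr_dominated_cvg0 c2 _ c0 => k.
  by case: (lyapunov_dominates zo po (z_ k) (p_ k) l).
apply: (@cvg_sub0 _ _ _ _ _ _ (cst (po l 0))); last exact: cvg_cst.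
apply: sqr_dominated_cvg0 c1 _ c0 => k.
by case: (lyapunov_dominates zo po (z_ k) (p_ k) l).
Qed.

Let sqr_bound (c C v : R) : 0 < c -> c * v ^+ 2 <= C -> `|v| <= 1 + C / c.
Proof.
move=> c0 le; apply: le_trans (_ : 1 + v ^+ 2 <= _).
  by rewrite -real_normK ?num_real//; have := sqr_ge0 (`|v| - 1); nra.
by rewrite lerD2l ler_pdivlMr// mulrC.
Qed.

Lemma lyapunov_cvg_bounded (zo po : 'cV[R]_W) :
  cvgn (fun k => lyapunov zo po (z_ k) (p_ k)) ->
  (forall l, exists C, forall k, `|z_ k l 0| <= C) /\
  (forall l, exists C, forall k, `|p_ k l 0| <= C).
Proof.
move=> /cvg_seq_bounded[C0 [_ hC]].
have {hC} [C hC] : exists C, forall k, lyapunov zo po (z_ k) (p_ k) <= C.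
  exists (C0 + 1) => k; apply: le_trans (ler_norm _) _.
  by apply: (hC (C0 + 1)) => //; rewrite ltrDl.
split=> l; have [c1 c2] := lyap_const l.
  exists (1 + C / (beta * h l ^+ 2 / pi (tl l)) + `|zo l 0|) => k.
  rewrite -[z_ k l 0](subrK (zo l 0)); apply: le_trans (ler_normD _ _) _.
  rewrite lerD2r; apply: sqr_bound c2 _.
  by apply: le_trans (hC k); case: (lyapunov_dominates zo po (z_ k) (p_ k) l).
exists (1 + C / (beta * pi (tl l))^-1 + `|po l 0|) => k.
rewrite -[p_ k l 0](subrK (po l 0)); apply: le_trans (ler_normD _ _) _.
rewrite lerD2r; apply: sqr_bound c1 _.
by apply: le_trans (hC k); case: (lyapunov_dominates zo po (z_ k) (p_ k) l).
Qed.

Lemma cluster_is_saddle (U : set_system nat) (zo po : 'cV[R]_W) :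
  ProperFilter U -> \oo `<=` U ->
  (forall l, z_ k l 0 @[k --> U] --> zo l 0) ->
  (forall l, p_ k l 0 @[k --> U] --> po l 0) ->
  exists xo, saddle_point f X Z D H xo zo po /\
    forall c, y_ k c 0 @[k --> U] --> xo c 0.
Proof.
move=> PU sU cz cp; have [yo [cy fs]] := cvg_y PU sU cz.
have zev : \forall k \near U, Z (z_ k) /\
    forall v, Z v -> \sum_l p_ k l 0 * (h l * (v l 0 - z_ k l 0)) <= 0.
  exact: sU eventually_z_optimal.
have cyb i j : block i (y_ k) j 0 @[k --> U] --> block i yo j 0.
  by under eq_fun do rewrite blockE; rewrite blockE; exact: cy.
have cdx l i : dx l (block i (y_ k)) @[k --> U] --> dx l (block i yo).
  by apply: cvgMr; exact: cyb.
exists yo; split=> //; apply: saddle_intro => //.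
- apply: (closed_cvg (F := U) (u_ := z_) _ Z_closed); last by apply: cvg_col; exact: cz.
  by apply: filterS zev => k [].
- move=> i; split.
    apply: (closed_cvg (F := U) (u_ := fun k => block i (y_ k)) _ (@X_closed i)); last by apply: cvg_col; exact: cyb.
    by apply: nearW => k; case: (yP (mkseq u k)) => /(_ i)[].
  move=> v Xv; rewrite lerBrDr -lerBrDl.
  (* The bound [g] is the optimality condition solved for the value of [f i] at the iterate; all its
     other terms converge. *)
  apply: (convex_lsc PU (@f_convex i) (cyb i)
    (g := fun k => f i v - \sum_(l | bi l == i) (p_ k l 0 -
       beta * (dx l (block i (y_ k)) + h l * z_ k l 0)) *
       (dx l v - dx l (block i (y_ k))))).
    move=> k; case: (yP (mkseq u k)) => /(_ i)[_ /(_ _ Xv)] + _.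
    by rewrite -/(y_ k) -/(z_ k) -/(p_ k); lra.
  apply: cvgB; first exact: cvg_cst.
  apply: cvg_sumr => l _; apply: cvgM; last by apply: cvgB => //; exact: cvg_cst.
  apply: cvgB => //; apply: cvgMr; apply: cvgD => //.
  by apply: cvgMr; exact: cz.
- move=> v Zv; apply: (cvgr_to_le (F := U)
    (f := fun k => \sum_l p_ k l 0 * (h l * (v l 0 - z_ k l 0)))).
    apply: cvg_sumr => l _; apply: cvgM => //; apply: cvgMr.
    by apply: cvgB => //; exact: cvg_cst.
  by apply: filterS zev => k [_]; apply.
Qed.

(** Once block [i] has been active after time [K], its value in [x_] is that of [y_] at its latest
    activation, which is no earlier than [K]. *)
Lemma x_cvg (xo : 'cV[R]_(N * n)) :
  (forall c, y_ k c 0 @[k --> \oo] --> xo c 0) ->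
  forall c, x_ k c 0 @[k --> \oo] --> xo c 0.
Proof.
move=> cy c; have := cy c; case/mxvec_indexP: c => i j cij.
have [t ti] := active_tl i j.
apply/cvgrPdist_lt => e e0; have /cvgrPdist_lt/(_ _ e0)[K _ yK] := cij.
have [k0 Kk0 uk0] := u_io t K; exists k0.+1 => // k; rewrite /= -!blockE.
elim: k => [|k IH]; first by rewrite ltn0.
rewrite ltnS => k0k.
have [ia|ina] := boolP (i \in active D (blk (u k))).
  have := (yP (mkseq u k)).2 _ _ ia; rewrite -mkseqS -/(x_ _) -/(y_ _) => ->.
  by rewrite !blockE; apply: yK; exact: leq_trans k0k.
rewrite (step_x_inactive (step_ k) ina); apply: IH.
rewrite ltn_neqAle k0k andbT; apply/eqP => k0E.
by rewrite -k0E uk0 ti in ina.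
Qed.

Theorem path_converges :
  (exists xo zo po, saddle_point f X Z D H xo zo po) ->
  (forall xo zo po, saddle_point f X Z D H xo zo po ->
     cvgn (fun k => lyapunov zo po (z_ k) (p_ k))) ->
  exists xo zo po, [/\ saddle_point f X Z D H xo zo po,
    x_ @ \oo --> xo, z_ @ \oo --> zo & p_ @ \oo --> po].
Proof.
move=> [x1 [z1 [p1 s1]]] lyapc.
have [bz bp] := lyapunov_cvg_bounded (lyapc _ _ _ s1).
have [U [UU sU]] := @ultraFilterLemma nat \oo _.
have PU : ProperFilter U by exact: ultra_proper.
have /choice[zo zoP] l : exists a : R, z_ k l 0 @[k --> U] --> a.
  by have [C hC] := bz l; apply: ultra_bounded_cvg UU _; apply: nearW hC.
have /choice[po poP] l : exists a : R, p_ k l 0 @[k --> U] --> a.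
  by have [C hC] := bp l; apply: ultra_bounded_cvg UU _; apply: nearW hC.
have cz l : z_ k l 0 @[k --> U] --> (\col_l zo l) l 0 by rewrite mxE.
have cp l : p_ k l 0 @[k --> U] --> (\col_l po l) l 0 by rewrite mxE.
have [xo [so _]] := cluster_is_saddle PU sU cz cp.
have /cvg_ex[L cL] := lyapc _ _ _ so.
(* Along [U] the iterates tend to the centre of this Lyapunov function, which forces its limit [L]
   to be 0. *)
have cU0 : lyapunov (\col_l zo l) (\col_l po l) (z_ k) (p_ k) @[k --> U] --> (0 : R).
  rewrite [X in _ --> X](_ : _ = \sum_l (pi (tl l))^-1 *
    gap (\col_l zo l) (\col_l po l) (\col_l zo l) (\col_l po l) l); last first.
    rewrite big1// => l _; rewrite /gap !subrr mulr0 !expr0n/= mul0r mulr0.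
    by rewrite addr0 mulr0.
  apply: cvg_sumr => l _; apply: cvgMr; rewrite /gap !expr2.
  have dp : p_ k l 0 - (\col_l po l) l 0 @[k --> U] -->
      (\col_l po l) l 0 - (\col_l po l) l 0 by apply: cvgB => //; exact: cvg_cst.
  have dz : h l * (z_ k l 0 - (\col_l zo l) l 0) @[k --> U] -->
      h l * ((\col_l zo l) l 0 - (\col_l zo l) l 0).
    by apply: cvgMr; apply: cvgB => //; exact: cvg_cst.
  by apply: cvgD; [apply: cvgMl; exact: cvgM|apply: cvgMr; exact: cvgM].
have cLU : lyapunov (\col_l zo l) (\col_l po l) (z_ k) (p_ k) @[k --> U] --> L.
  by apply: cvg_trans cL; exact: cvg_app sU.
have L0 := cvg_unique (@Rhausdorff R) cLU cU0; rewrite L0 in cL.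
have [czo cpo] := cvg_of_lyapunov0 cL.
(* The cluster argument is repeated along [\oo] itself, to obtain convergence of the whole sequence
   [y_]. *)
have [xs' [sad cy]] := cluster_is_saddle _ (fun A => id) czo cpo.
exists xs', (\col_l zo l), (\col_l po l); split=> //; apply: cvg_col => //.
exact: x_cvg.
Qed.

(** Half the gradient at [(z, p)] of the Lyapunov function centred at [(z0, p0)]. *)
Let grad (z0 p0 z p : 'cV[R]_W) : 'cV[R]_(W + W) :=
  col_mx (\col_l ((pi (tl l))^-1 * (beta * h l ^+ 2 * (z l 0 - z0 l 0))))
         (\col_l ((pi (tl l))^-1 * ((p l 0 - p0 l 0) / beta))).

(* The quadratic part of the Lyapunov function does not depend on its centre,
   so that moving the centre only adds an affine function of the iterate. *)
Lemma lyapunov_shift (z0 p0 z p : 'cV[R]_W) (dd : 'cV[R]_(W + W)) :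
  lyapunov (z0 + usubmx dd) (p0 + dsubmx dd) z p =
  lyapunov z0 p0 z p - 2 * dot (grad z0 p0 z p) dd +
  lyapunov z0 p0 (z0 + usubmx dd) (p0 + dsubmx dd).
Proof.
rewrite dotE big_split_ord /= mulrDr !mulr_sumr /lyapunov -!big_split/=.
rewrite -sumrB -big_split/=; apply: eq_bigr => l _.
rewrite /gap col_mxEu col_mxEd !mxE.
by field; rewrite !gt_eqF.
Qed.

(** Saddle points may be uncountable, too many for one almost sure event each. By [lyapunov_shift],
    convergence at a shifted centre reduces to that of a functional linear in the shift, so spanning
    shifts suffice. *)
Lemma finite_saddle_test :
  (exists xo zo po, saddle_point f X Z D H xo zo po) ->
  exists2 L : seq ('cV[R]_W * 'cV[R]_W), L != [::] &
  (forall c, c \in L -> exists xo, saddle_point f X Z D H xo c.1 c.2) /\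
  forall zk pk : nat -> 'cV[R]_W,
    (forall c, c \in L -> cvgn (fun k => lyapunov c.1 c.2 (zk k) (pk k))) ->
  forall xo zo po, saddle_point f X Z D H xo zo po ->
    cvgn (fun k => lyapunov zo po (zk k) (pk k)).
Proof.
move=> [x0 [z0 [p0 s0]]].
pose S : set 'cV[R]_(W + W) := [set dd | exists xo,
  saddle_point f X Z D H xo (z0 + usubmx dd) (p0 + dsubmx dd)].
have [l [lS Sl]] := finite_spanning_subset S.
exists ((z0, p0) :: [seq (z0 + usubmx dd, p0 + dsubmx dd) | dd <- l]) => //.
split=> [c|zk pk lcv xo zo po so].
  by rewrite inE => /orP[/eqP ->|/mapP[dd /lS ? ->]//]; exists x0.
have c0 : cvgn (fun k => lyapunov z0 p0 (zk k) (pk k)).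
  by apply: (lcv (z0, p0)); rewrite inE eqxx.
pose dd := col_mx (zo - z0) (po - p0).
have zoE : zo = z0 + usubmx dd by rewrite col_mxKu addrC subrK.
have poE : po = p0 + dsubmx dd by rewrite col_mxKd addrC subrK.
have Sdd : S dd by exists xo; rewrite -zoE -poE.
have cgrad : cvgn (fun k => dot (grad z0 p0 (zk k) (pk k)) dd).
  have /choice[a aP] (i : 'I_(size l)) : exists a : R,
      dot (grad z0 p0 (zk k) (pk k)) l`_i @[k --> \oo] --> a.
    apply/cvg_ex; have il : l`_i \in l by exact: mem_nth.
    have ci : cvgn (fun k =>
        lyapunov (z0 + usubmx l`_i) (p0 + dsubmx l`_i) (zk k) (pk k)).
      apply: (lcv (_, _)); rewrite inE; apply/orP; right.
      by apply/mapP; exists l`_i.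
    rewrite (_ : (fun k => _) = (fun k => 2^-1 * (lyapunov z0 p0 (zk k) (pk k) -
        lyapunov (z0 + usubmx l`_i) (p0 + dsubmx l`_i) (zk k) (pk k) +
        lyapunov z0 p0 (z0 + usubmx l`_i) (p0 + dsubmx l`_i)))); last first.
      by apply/funext => k; rewrite lyapunov_shift; field.
    apply: is_cvgMr; apply: is_cvgD; last exact: is_cvg_cst.
    exact: is_cvgB.
  rewrite (@coord_span _ _ _ (in_tuple l) _ (Sl _ Sdd)).
  apply/cvg_ex; exists (\sum_i coord (in_tuple l) i dd * a i).
  under eq_fun do rewrite dot_sumr.
  by apply: cvg_sumr => i _; under eq_fun do rewrite dotZr; exact: cvgMr.
rewrite zoE poE; under eq_fun do rewrite lyapunov_shift.
apply: is_cvgD; last exact: is_cvg_cst.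
by apply: is_cvgB => //; exact: is_cvgMr.
Qed.

End Tree.

End Step.

(** * From the tree of histories to the probability space *)

Lemma ae_forall_seq d (T : measurableType d) (R : realType)
    (mu : {measure set T -> \bar R}) (I : eqType) (s : seq I)
    (Q : I -> T -> Prop) :
  (forall i, i \in s -> {ae mu, forall w, Q i w}) ->
  {ae mu, forall w, forall i, i \in s -> Q i w}.
Proof.
elim: s => [|i s IH] h; first by apply: aeW => w i; rewrite in_nil.
have h1 := h i (mem_head _ _).
have h2 : {ae mu, forall w, forall j, j \in s -> Q j w}.
  by apply: IH => j js; apply: h; rewrite inE js orbT.
apply: filterS2 h1 h2 => w Qi Qs j.
by rewrite inE => /orP[/eqP ->|/Qs].
Qed.

Theorem mainTheorem1 (R : realType) (N n W : nat)
  (f : 'I_N -> 'cV[R]_n -> R)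
  (X : 'I_N -> set 'cV[R]_n) (Z : set 'cV[R]_W)
  (D : 'M[R]_(W, N * n)) (H : 'M[R]_W)
  (Pi : {set {set 'I_W}}) (beta : R)
  (x0 : 'cV[R]_(N * n)) (z0 : 'cV[R]_W)
  (d : measure_display) (Omega : measurableType d) (P : probability Omega R)
  (Psi : nat -> Omega -> {set 'I_W})
  (x : nat -> Omega -> 'cV[R]_(N * n)) (z p : nat -> Omega -> 'cV[R]_W)
  (f_convex : forall i, convex_function [set: 'cV[R]_n] (f i))
  (X_closed : forall i, closed (X i)) (X_convex : forall i, convex_set (X i))
  (Z_closed : closed Z) (Z_convex : convex_set Z)
  (saddle_exists : exists xs zs ps, saddle_point f X Z D H xs zs ps)
  (DH_decoupled : decoupled D H)
  (Pi_proper : proper_partition Pi Z)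
  (Psi_in : forall k w, Psi k w \in Pi)
  (Psi_iid : iid P (fun k w => (active D (Psi k w), Psi k w)))
  (Psi_pos : forall k psi, psi \in Pi ->
     (0 < P [set w | Psi k w = psi])%E)
  (beta_gt0 : 0 < beta)
  (x0_in : prodX X x0) (z0_in : Z z0)
  (admm : forall w, async_admm f X Z D H beta x0 z0
     (fun k => active D (Psi k w)) (fun k => Psi k w)
     (fun k => x k w) (fun k => z k w) (fun k => p k w)) :
  {ae P, forall w, exists xs zs ps,
     [/\ saddle_point f X Z D H xs zs ps,
         x k w @[k --> \oo] --> xs,
         z k w @[k --> \oo] --> zs &
         p k w @[k --> \oo] --> ps]}.
Proof.
have [bi [bj [q [h [DE HE q0 h0 D_surj]]]]] := decoupledP DH_decoupled.
have [[w0]|noO] := pselect (inhabited Omega); last first.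
  by apply: aeW => w; case: noO.
pose T : finType := {psi : {set 'I_W} | psi \in Pi}.
pose Y k w : T := exist _ (Psi k w) (Psi_in k w).
have iidY : iid P Y.
  (* The active set is dropped from the pair; the default of [insubd] never occurs, by [Psi_in]. *)
  have := iid_comp (fun ab => insubd (Y 0%N w0) ab.2) Psi_iid.
  congr (iid P _); apply/funext => k; apply/funext => w.
  by apply: val_inj; rewrite val_insubd Psi_in.
pose pi := law P Y.
have pi_gt0 t : 0 < pi t.
  rewrite -lte_fin -(lawE iidY 0%N).
  have := Psi_pos 0%N (val t) (valP t); congr (_ < P _)%E.
  by apply/seteqP; split => w /= e; [exact: val_inj|rewrite -e].
have pi_ge0 t : 0 <= pi t by exact: ltW.
have pi_sum : \sum_t pi t = 1 := law_sum iidY.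
have cmeas s : measurable (cylinder Y s) by case: (iid_cylinder iidY s).
have cP s : P (cylinder Y s) = (\prod_(t <- s) pi t)%:E.
  by case: (iid_cylinder iidY s).
(* Every finite history has positive probability, so some sample point realizes it; the state after
   [s] is read off there. *)
have /choice[om omP] s : exists w, history Y (size s) w = s.
  apply: contrapT => no; have : (0 < P (cylinder Y s))%E.
    by rewrite cP lte_fin prodr_gt0.
  rewrite (_ : cylinder Y s = set0) ?measure0 ?ltxx//.
  by apply/seteqP; split => // w sw; apply: no; exists w.
have determined k w w' : history Y k w = history Y k w' ->
    [/\ x k w = x k w', z k w = z k w' & p k w = p k w'].
  elim: k => [_|k IH].
    by case: (admm w) => -> -> -> _; case: (admm w') => -> -> -> _.
  rewrite !historyS => /rcons_inj[/IH[ex ez ep] eY].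
  case: (admm w) => _ _ _ /(_ k); case: (admm w') => _ _ _ /(_ k).
  rewrite ex ez ep eY => s1 s2.
  exact: (step_determined f_convex X_convex Z_convex beta_gt0 DE HE q0 h0 D_surj s2 s1).
pose xs s := x (size s) (om s); pose zs s := z (size s) (om s).
pose ps s := p (size s) (om s).
have hist k w : [/\ xs (history Y k w) = x k w, zs (history Y k w) = z k w &
    ps (history Y k w) = p k w].
  rewrite /xs /zs /ps size_history; apply: determined.
  by rewrite -{1}(size_history Y k w) omP.
have steps s t : admm_step f X Z D H beta (active D (val t)) (val t)
    (xs s) (zs s) (ps s) (xs (rcons s t)) (zs (rcons s t)) (ps (rcons s t)).
  have := omP (rcons s t); set w := om (rcons s t).
  rewrite size_rcons historyS => /rcons_inj[hs Yt].
  have [ex ez ep] := hist (size s) w; rewrite hs in ex ez ep.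
  have [ex' ez' ep'] := hist (size s).+1 w; rewrite historyS hs Yt in ex' ez' ep'.
  rewrite ex ez ep ex' ez' ep' -Yt.
  by case: (admm w) => _ _ _ /(_ (size s)).
case: Pi_proper => partPi ZE.
have [/eqP covPi trivPi _] := and3P partPi.
have in_cover l : l \in finset.cover Pi by rewrite covPi inE.
pose tl l : T := exist _ (finset.pblock Pi l) (finset.pblock_mem (in_cover l)).
have blkE (t : T) l : (l \in val t) = (t == tl l).
  rewrite -val_eqE /=; apply/idP/eqP => [lt|->]; last by rewrite finset.mem_pblock.
  by rewrite (finset.def_pblock trivPi (valP t) lt).
have Z_prod (y : 'cV[R]_W) : (forall t : T,
    exists2 y', Z y' & forall l, l \in val t -> y' l 0 = y l 0) -> Z y.
  move=> hy; rewrite ZE => psi psiPi; have [y' Zy' e] := hy (exist _ psi psiPi).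
  by exists y' => //; apply/colP => l; rewrite !mxE; case: ifP => // /e.
have xs0 : prodX X (xs [::]).
  by rewrite /xs; case: (admm (om [::])) => /= -> _ _ _.
have [y yP] := full_update_ex f_convex X_convex beta_gt0 DE HE q0 D_surj blkE
  xs0 steps.
have [L Lne [Lsad Lcvg]] := finite_saddle_test beta_gt0 h tl pi_gt0 saddle_exists.
have aeV : {ae P, forall w, forall c, c \in L ->
    cvgn (fun k => lyapunov beta h tl pi c.1 c.2
            (zs (history Y k w)) (ps (history Y k w))) /\
    residual beta bi bj q h zs y (history Y k w) @[k --> \oo] --> (0 : R)}.
  apply: ae_forall_seq => c /Lsad[xo sad].
  apply: (supermart_ae_cvg pi_ge0 pi_sum cmeas cP
    (V := fun s => lyapunov beta h tl pi c.1 c.2 (zs s) (ps s))).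
  - by move=> s; exact: lyapunov_ge0.
  - by move=> s; exact: residual_ge0.
  - move=> s; exact: (lyapunov_decrease Z_convex beta_gt0 DE HE q0 blkE pi_gt0
      pi_sum Z_prod steps yP s sad).
have aeio : {ae P, forall w, forall t, t \in enum T ->
    forall m : nat, exists2 k, (m <= k)%N & Y k w = t}.
  apply: ae_forall_seq => t _.
  exact: (ae_infinitely_often pi_ge0 pi_sum cmeas cP (pi_gt0 t)).
apply: filterS2 aeV aeio => w Vw io.
have io' t m : exists2 k, (m <= k)%N & Y k w = t by apply: io; rewrite mem_enum.
(* The residual is independent of the saddle point, so any member of the nonempty [L] gives its
   limit. *)
have res0 : residual beta bi bj q h zs y (mkseq (Y^~ w) k) @[k --> \oo] --> (0 : R).
  case: L Lne Vw {Lsad Lcvg} => // c L _ /(_ c (mem_head _ _))[_].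
  exact.
have [xo [zo [po [sad cx cz cp]]]] := path_converges f_convex Z_convex beta_gt0
  DE HE q0 h0 D_surj blkE pi_gt0 steps yP X_closed Z_closed io' res0
  saddle_exists (Lcvg _ _ (fun c cL => (Vw c cL).1)).
have [ex ez ep] : [/\ x^~ w = (fun k => xs (history Y k w)),
    z^~ w = (fun k => zs (history Y k w)) & p^~ w = (fun k => ps (history Y k w))].
  by split; apply/funext => k; have [ex ez ep] := hist k w; rewrite ?ex ?ez ?ep.
by exists xo, zo, po; rewrite ex ez ep.
Qed.
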